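(* Let $a,c$ be nonzero complex numbers and let $\ell,m,n$ be nonnegative integers. Then $$ {}_4\phi_3\left[\begin{matrix}a,\,c,\,q^{-n},\,-q^{1-\ell+m+n}a/c\\ q^{1-\ell}a/c,\,q^{1+m+n}a,\,-q^{-n}c\end{matrix};q,q\right] =\frac{(a,\,c;q)_\ell}{(q^{\ell-1}c^2,\,q^{1-\ell}a/c;q)_\ell}\, \frac{(q^{1+m+n},\,-qa/c;q)_n}{(q^{1+m+n}a,\,-q/c;q)_n}\sum_{i=0}^{\ell}\sum_{j=0}^{m}T_{i,j}, $$ where $$ T_{i,j}=(-1)^{j}q^{\ell i-nj+\binom{j+1}{2}}\Big(\frac{c}{a}\Big)^i\,\frac{1-q^{1-2\ell+2i}/c^2}{1-q^{1-2\ell}/c^2}\, \frac{(q^{-\ell},\,q^{1-\ell}a/c^2,\,q^{1-2\ell}/c^2;q)_i}{(q,\,q^{1-\ell}/a,\,q^{2-\ell}/c^2;q)_i} $$ $$ \times\frac{(q^{-m},\,q^{-m-n},\,-q^{-m-n},\,q^{\ell-i}a,\,q^{1-\ell+i}a/c^2;q)_j}{(q,\,qa/c,\,-qa/c,\,q^{-m-2n},\,q^{j-2m-2n-1};q)_j}\, \frac{(q^{1+\ell-i+j}a,\,q^{2-\ell+i+j}a/c^2;q^2)_{m+n-j}}{(q,\,q^{2+2j}a^2/c^2;q^2)_{m+n-j}}. $$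
   Context: $q$ is a nonzero complex number. For complex $x$ and an integer $n\ge 0$, the $q$-shifted factorial is $(x;q)_0=1$, $(x;q)_n=\prod_{k=0}^{n-1}(1-xq^k)$, and $(x_1,\dots,x_r;q)_n=\prod_{s=1}^r (x_s;q)_n$ (likewise with base $q^2$ in place of $q$). The basic hypergeometric series is ${}_4\phi_3\left[\begin{matrix}a_0,a_1,a_2,a_3\\ b_1,b_2,b_3\end{matrix};q,z\right]=\sum_{k\ge0}\frac{(a_0,a_1,a_2,a_3;q)_k}{(q,b_1,b_2,b_3;q)_k}z^k$. Here one upper parameter is $q^{-n}$, so the series terminates and means the sum over $0\le k\le n$. Parameters are assumed to be such that no zero factor appears in a denominator of the displayed expressions. *)

(* Defs.v *)
From mathcomp Require Import all_boot all_order all_algebra.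
From mathcomp Require Import complex reals.

Set Implicit Arguments.
Unset Strict Implicit.
Unset Printing Implicit Defensive.

Import GRing.Theory.
Local Open Scope ring_scope.

(* (x; q)_n *)
Definition qpoch (F : fieldType) (q x : F) (n : nat) : F :=
  \prod_(k < n) (1 - x * q ^+ k).

(* (x_1, ..., x_r; q)_n; it is nonzero iff none of its factors
   1 - x_s q^k, k < n, is zero *)
Definition qpochs (F : fieldType) (q : F) (xs : seq F) (n : nat) : F :=
  \prod_(x <- xs) qpoch q x n.

(* The basic hypergeometric series 4phi3[a0,a1,a2,a3; b1,b2,b3; q, z], summed
   over 0 <= k <= n.  This is its value when it terminates because one of the
   upper parameters is q^-n. *)
Definition phi43 (F : fieldType) (n : nat) (q a0 a1 a2 a3 b1 b2 b3 z : F) : F :=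
  \sum_(k < n.+1)
    qpochs q [:: a0; a1; a2; a3] k / qpochs q [:: q; b1; b2; b3] k * z ^+ k.

(* The summand T_{i,j}.  The last quotient is in base q^2. *)
Definition Tterm (F : fieldType) (q a c : F) (l m n i j : nat) : F :=
  (-1) ^+ j * q ^ (l%:Z * i%:Z - n%:Z * j%:Z + 'C(j.+1, 2)%:Z) * (c / a) ^+ i
  * ((1 - q ^ (1 - 2 * l%:Z + 2 * i%:Z) / c ^+ 2)
     / (1 - q ^ (1 - 2 * l%:Z) / c ^+ 2))
  * (qpochs q [:: q ^ (- l%:Z); q ^ (1 - l%:Z) * a / c ^+ 2;
                  q ^ (1 - 2 * l%:Z) / c ^+ 2] i
     / qpochs q [:: q; q ^ (1 - l%:Z) / a; q ^ (2 - l%:Z) / c ^+ 2] i)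
  * (qpochs q [:: q ^ (- m%:Z); q ^ (- m%:Z - n%:Z); - q ^ (- m%:Z - n%:Z);
                  q ^ (l%:Z - i%:Z) * a;
                  q ^ (1 - l%:Z + i%:Z) * a / c ^+ 2] j
     / qpochs q [:: q; q * a / c; - (q * a / c); q ^ (- m%:Z - 2 * n%:Z);
                    q ^ (j%:Z - 2 * m%:Z - 2 * n%:Z - 1)] j)
  * (qpochs (q ^+ 2) [:: q ^ (1 + l%:Z - i%:Z + j%:Z) * a;
                         q ^ (2 - l%:Z + i%:Z + j%:Z) * a / c ^+ 2] (m + n - j)
     / qpochs (q ^+ 2) [:: q; q ^ (2 + 2 * j%:Z) * a ^+ 2 / c ^+ 2] (m + n - j)).

(* Main.v *)
Require Import Defs.
From mathcomp Require Import all_boot all_order all_algebra.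
From mathcomp Require Import complex reals.
From mathcomp Require Import ring zify.

(* Sears' transformation, applied to the balanced series on the left, moves the
   factor involving n out and leaves
     4phi3[a, q^(1-l) a/c^2, q^-n, -q^-M; q^(1-l) a/c, -qa/c, q^-(M+n)], M = m + n.
   Two terminating very-well-poised 6phi5 sums (with d^2 = qA, so that one pair
   of parameters cancels) rewrite its coefficients: the first one gives
     (a, q^(1-l) a/c^2)_k / (q^(1-l) a/c)_k
       = sum_i const_i (q^(l-i) a, q^(1-l+i) a/c^2)_k / (qa/c)_k,
   the second one turns (q^-n)_k / (q^-(M+n))_k into a combination of shifted
   (q^-M)_k / (q^-2M)_k.  What remains for given i and j is Andrews' terminating
   q-Watson sum.  The Saalschuetz, 6phi5 and q-Watson sums come from WZ pairs.

   This argument divides by factors that may vanish at the given q, a, c, so it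
   is carried out for multiplicatively independent q, a, c in a field.  The
   general case follows by replacing q, a, c by linear polynomials in a variable
   t and specialising the resulting identity of rational functions. *)

Set Implicit Arguments.
Unset Strict Implicit.
Unset Printing Implicit Defensive.

Import GRing.Theory Num.Theory.
Local Open Scope ring_scope.

Ltac nz := repeat (apply/andP; split);
  try assumption; try exact: oner_neq0;
  try (rewrite oppr_eq0; exact: oner_neq0); try (apply: expf_neq0; assumption).
(* Proves [v != 0] when [field] shows that [v] is the product of the terms
   that [h1] and [h2] assert to be nonzero. *)
Ltac nzm h1 h2 := let h := fresh in have h := mulf_neq0 h1 h2;
  match type of h with is_true (?u != 0) =>
  match goal with |- is_true (?v != 0) =>
    rewrite (_ : v = u) //; field; nz end end.

(** * Terminating summation formulas *)

Section QShifted.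
Variables (F : fieldType) (q : F).
Implicit Types (x y A B C : F) (n k j : nat).

Lemma qpoch0 x : qpoch q x 0 = 1.
Proof. exact: big_ord0. Qed.

Lemma qpochS x n : qpoch q x n.+1 = qpoch q x n * (1 - x * q ^+ n).
Proof. exact: big_ord_recr. Qed.

Lemma qpochD x m n : qpoch q x (m + n) = qpoch q x m * qpoch q (x * q ^+ m) n.
Proof.
elim: n => [|n IH]; first by rewrite addn0 qpoch0 mulr1.
by rewrite addnS !qpochS IH exprD !mulrA.
Qed.

Lemma qpochSl x n : qpoch q x n.+1 = (1 - x) * qpoch q (x * q) n.
Proof. by rewrite -add1n qpochD qpochS qpoch0 expr0 expr1 mulr1 mul1r. Qed.

Lemma qpoch_neq0P x n :
  reflect (forall k, (k < n)%N -> 1 - x * q ^+ k != 0) (qpoch q x n != 0).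
Proof.
apply: (iffP idP) => [/prodf_neq0 H k kn|H]; first exact: (H (Ordinal kn)).
by apply/prodf_neq0 => k _; apply: H.
Qed.

Lemma qpoch_neq0_leq x n k : (k <= n)%N -> qpoch q x n != 0 -> qpoch q x k != 0.
Proof. by move=> /subnKC <-; rewrite qpochD mulf_eq0 negb_or => /andP[]. Qed.

(** Finite form of the WZ argument: the differences of the certificate [H] telescope. The boundary
    term [H n] is kept; in the applications it vanishes at the chosen upper bound. *)
Lemma partial_sums (al be : F) (f g H : nat -> F) n :
  al * f 0%N - be * g 0%N = H 0%N ->
  (forall k, (k < n)%N -> al * f k.+1 - be * g k.+1 = H k.+1 - H k) ->
  al * (\sum_(k < n.+1) f k) - be * (\sum_(k < n.+1) g k) = H n.
Proof.
move=> H0; elim: n => [|n IH] HS; first by rewrite !big_ord1.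
rewrite big_ord_recr [X in be * X]big_ord_recr /= !mulrDr opprD addrACA.
by rewrite HS // IH ?subrKC // => k kn; apply: HS; apply: leq_trans kn _.
Qed.

(** Summand of the balanced 3phi2 with upper parameters [A], [B], [y]: the lower parameters multiply
    to [A * B * y * q]. *)
Definition saalschutz_term A B C y k :=
  qpoch q y k * qpoch q A k * qpoch q B k * q ^+ k
  / (qpoch q q k * qpoch q C k * qpoch q (A * B * q * y / C) k).

(* y stands for q^-n, so that y -> y / q is the shift n -> n + 1 (in watson_wz:
   q^-2n and y / q^2).  The right-hand side is the WZ certificate, which vanishes
   for j > n through its factor (y)_j. *)
Lemma saalschutz_wz A B C y j : q != 0 -> A != 0 -> B != 0 -> C != 0 -> y != 0 ->
  qpoch q q j != 0 -> qpoch q C j != 0 -> qpoch q (A * B * y / C) j.+1 != 0 ->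
  (1 - C / y) * (1 - C / (A * B * y)) * (\sum_(k < j.+1) saalschutz_term A B C (y / q) k)
  - (1 - C / (A * y)) * (1 - C / (B * y)) * (\sum_(k < j.+1) saalschutz_term A B C y k)
  = - (C / (A * B * y)) * saalschutz_term A B C y j
    * (1 - A * q ^+ j) * (1 - B * q ^+ j) / q ^+ j.
Proof.
move=> q0 A0 B0 C0 y0 hq hC hD.
pose H k := - (C / (A * B * y)) * saalschutz_term A B C y k
    * (1 - A * q ^+ k) * (1 - B * q ^+ k) / q ^+ k.
apply: (@partial_sums _ _ _ _ H) => [|k kj].
  by rewrite /H /saalschutz_term /= !qpoch0 !expr0; field; nz.
have {hq} := qpoch_neq0_leq kj hq.
have {hC} := qpoch_neq0_leq kj hC.
have {hD} : qpoch q (A * B * y / C) k.+2 != 0 by exact: qpoch_neq0_leq hD.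
rewrite /H /saalschutz_term.
have -> : A * B * q * (y / q) / C = A * B * y / C by field; nz.
rewrite (qpochSl (y / q)) (qpochSl (A * B * y / C) k) (qpochSl (A * B * y / C) k.+1).
have -> : y / q * q = y by field; nz.
have -> : A * B * y / C * q = A * B * q * y / C by field; nz.
rewrite !qpochS !exprS !mulf_eq0 !negb_or.
move: (expf_neq0 k q0).
move: (qpoch q y k) (qpoch q A k) (qpoch q B k) (qpoch q q k) (qpoch q C k).
move: (qpoch q _ k); move: (q ^+ k) => x U a b c d e x0.
move=> /andP[h1 /andP[h2 h3]] /andP[h4 h5] /andP[h6 h7].
field; nz.
- by nzm C0 h3.
- by nzm C0 h1.
Qed.
End QShifted.

Section Creative.
Variables (F : fieldType) (q : F).
Implicit Types (x y A B C a b c d : F) (n k j : nat).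

Lemma qpoch_terminates n k : q != 0 -> (n < k)%N -> qpoch q (q ^- n) k = 0.
Proof.
move=> q0 nk; apply/eqP; apply: contraT => /qpoch_neq0P/(_ n nk).
by rewrite mulVf ?subrr ?eqxx ?expf_neq0.
Qed.

Lemma inv_neq1 x : 1 - x != 0 -> 1 - x^-1 != 0.
Proof. by rewrite !subr_eq0 ![1 == _]eq_sym invr_eq1. Qed.

(** The factor 1 - q^i/q^m is 1 - 1/q^(m-i), and 1 - q^(m-i) is one of the factors of (q)_m. *)
Lemma qpoch_neg_neq0 m k : q != 0 -> (k <= m)%N -> qpoch q q m != 0 ->
  qpoch q (q ^- m) k != 0.
Proof.
move=> q0 km /qpoch_neq0P hm; apply/qpoch_neq0P => i ik.
have im : (i < m)%N by exact: leq_trans ik km.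
rewrite -(subnK (ltnW im)) exprD invfM mulfVK ?expf_neq0 //.
apply: inv_neq1; have := hm (m - i.+1)%N; rewrite -exprS subnSK //.
by apply; rewrite leq_subr.
Qed.

(** Induction on [n] through [saalschutz_wz]. The condition covers [n.+1] factors, one more than the
    summands contain: the last one, 1 - ABq/C, is needed to use the certificate one place beyond the
    end of the sum. *)
Lemma q_saalschutz A B C n : q != 0 -> A != 0 -> B != 0 -> C != 0 ->
  qpoch q q n != 0 -> qpoch q C n != 0 ->
  qpoch q (A * B * q / (C * q ^+ n)) n.+1 != 0 ->
  \sum_(k < n.+1) saalschutz_term q A B C (q ^- n) k
  = qpoch q (C / A) n * qpoch q (B * q / (C * q ^+ n)) n * A ^+ n
    / (qpoch q C n * qpoch q (A * B * q / (C * q ^+ n)) n).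
Proof.
move=> q0 A0 B0 C0; elim: n => [|n IH] hq hC hD.
  by rewrite big_ord1 /saalschutz_term !qpoch0 !expr0 !mulr1.
have N0 : q ^+ n != 0 by rewrite expf_neq0.
have e1 : A * B * q / (C * q ^+ n.+1) = A * B / (C * q ^+ n).
  by rewrite exprS; field; nz.
have e2 : B * q / (C * q ^+ n.+1) = B / (C * q ^+ n).
  by rewrite exprS; field; nz.
have e3 : A * B / (C * q ^+ n) * q = A * B * q / (C * q ^+ n) by field; nz.
have e4 : B / (C * q ^+ n) * q = B * q / (C * q ^+ n) by field; nz.
move: hD; rewrite e1 e2 => hD.
have hD2 : qpoch q (A * B * q / (C * q ^+ n)) n.+1 != 0.
  by move: hD; rewrite qpochSl e3 mulf_eq0 negb_or => /andP[].
(* At [j = n.+1] the sum for q^-(n+1) is complete, while the certificate and the last term of the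
   sum for q^-n both contain (q^-n)_(n+1) = 0. *)
have := @saalschutz_wz _ q A B C (q ^- n) n.+1 q0 A0 B0 C0 (invr_neq0 N0) hq hC.
rewrite (_ : A * B * q ^- n / C = A * B / (C * q ^+ n)); last by field; nz.
move=> /(_ hD).
rewrite {3}/saalschutz_term qpoch_terminates // !(mulr0, mul0r).
rewrite [X in _ - _ * X]big_ord_recr /= {3}/saalschutz_term qpoch_terminates // !(mul0r, addr0).
rewrite IH //; [|exact: qpoch_neq0_leq hq|exact: qpoch_neq0_leq hC].
have -> : q ^- n / q = q ^- n.+1 by rewrite exprSr invfM.
set S := \sum_(k < _) _ => HS.
move: hC hD; rewrite !(qpochS _ C) (qpochS _ (C / A)) (qpochSl _ (B / _) n).
rewrite (qpochSl _ (A * B / _) n.+1) (qpochSl _ (A * B / _) n).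
rewrite e3 e4 exprS !mulf_eq0 !negb_or.
move=> /andP[hC1 hC2] /andP[hD1 hD3].
have hD4 : qpoch q (A * B * q / (C * q ^+ n)) n != 0 by exact: qpoch_neq0_leq hD2.
have h : (1 - C * q ^+ n) * (1 - C * q ^+ n / (A * B)) != 0.
  rewrite mulf_neq0 //.
  have -> : C * q ^+ n / (A * B) = (A * B / (C * q ^+ n))^-1 by field; nz.
  exact: inv_neq1.
apply: (mulfI h); move/eqP: HS; rewrite subr_eq0 => /eqP.
rewrite !invrK => HS.
have e5 : C * q ^+ n / (A * B) = C / (A * B / q ^+ n) by field; nz.
rewrite e5.
rewrite HS; field; nz.
have N1 := mulf_neq0 C0 N0.
by nzm N1 hD1.
Qed.

(* Very-well-poised with A = d^2 / q; the pair (d, qA / d) cancels. *)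
Definition vwp_core b d y k :=
  qpoch q (d ^+ 2 / q) k * qpoch q b k * qpoch q y k * (d / (b * y)) ^+ k
  / (qpoch q q k * qpoch q (d ^+ 2 / b) k * qpoch q (d ^+ 2 / y) k).

Definition vwp_term b d y k :=
  (1 - d ^+ 2 / q * (q ^+ k) ^+ 2) / (1 - d ^+ 2 / q) * vwp_core b d y k.

(** WZ recurrence for the shift y -> y / q. The certificate is a multiple of [vwp_core], without the
    factor 1 - A q^(2j), and vanishes with (y)_j. *)
Lemma vwp_wz b d y j : q != 0 -> b != 0 -> d != 0 -> y != 0 ->
  1 - d ^+ 2 / q != 0 ->
  qpoch q q j != 0 -> qpoch q (d ^+ 2 / b) j != 0 ->
  qpoch q (d ^+ 2 / y) j.+1 != 0 ->
  (1 - d ^+ 2 / (b * y)) * (1 - d / y) * (\sum_(k < j.+1) vwp_term b d (y / q) k)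
  - (1 - d ^+ 2 / y) * (1 - d / (b * y)) * (\sum_(k < j.+1) vwp_term b d y k)
  = (1 - d ^+ 2 / y) * vwp_core b d y j * (1 - d ^+ 2 / q * q ^+ j)
    * (1 - b * q ^+ j) * (1 - d * q ^+ j) * (d / (b * y))
    / ((1 - d ^+ 2 / q) * (1 - d ^+ 2 / y * q ^+ j)).
Proof.
move=> q0 b0 d0 y0 hd hq hC hD.
pose H k := (1 - d ^+ 2 / y) * vwp_core b d y k * (1 - d ^+ 2 / q * q ^+ k)
    * (1 - b * q ^+ k) * (1 - d * q ^+ k) * (d / (b * y))
    / ((1 - d ^+ 2 / q) * (1 - d ^+ 2 / y * q ^+ k)).
apply: (@partial_sums _ _ _ _ _ H) => [|k kj].
  move: hD; rewrite qpochSl mulf_eq0 negb_or => /andP[h1 _].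
  rewrite /H /vwp_term /vwp_core /= !qpoch0 !expr0.
  by field; nz; first [nzm y0 h1 | nzm q0 hd].
have {hq} := qpoch_neq0_leq kj hq.
have {hC} := qpoch_neq0_leq kj hC.
have {hD} : qpoch q (d ^+ 2 / y) k.+2 != 0 by exact: qpoch_neq0_leq hD.
rewrite /H /vwp_term /vwp_core.
have e1 : d ^+ 2 / (y / q) = d ^+ 2 / y * q by field; nz.
have e2 : d / (b * (y / q)) = d / (b * y) * q by field; nz.
have e3 : y / q * q = y by field; nz.
(* The shift turns (d^2/y) into (q d^2/y); [e4] expresses the new product by the old one, so that
   [field] sees a single unknown. *)
rewrite (qpochSl _ (y / q)) e1 e2 e3 exprMn.
have e4 : (1 - d ^+ 2 / y) * qpoch q (d ^+ 2 / y * q) k.+1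
   = qpoch q (d ^+ 2 / y) k * (1 - d ^+ 2 / y * q ^+ k) * (1 - d ^+ 2 / y * q ^+ k.+1).
  by rewrite -qpochSl !qpochS.
move=> hD hC hq.
have /andP[hy1 hy2] : (1 - d ^+ 2 / y != 0) && (qpoch q (d ^+ 2 / y * q) k.+1 != 0).
  by rewrite -negb_or -mulf_eq0 -qpochSl.
have {e4} -> : qpoch q (d ^+ 2 / y * q) k.+1
   = qpoch q (d ^+ 2 / y) k * (1 - d ^+ 2 / y * q ^+ k) * (1 - d ^+ 2 / y * q ^+ k.+1)
   / (1 - d ^+ 2 / y).
  by rewrite -e4 [RHS]mulrAC divff // mul1r.
move: hq hC hD {hy2}.
rewrite !qpochS (exprS q) (exprS (d / _)) !mulf_eq0 !negb_or.
move: (expf_neq0 k q0).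
move: (qpoch q y k) (qpoch q b k) (qpoch q q k).
move: (qpoch q _ k) (qpoch q _ k) (qpoch q _ k) ((d / (b * y)) ^+ k).
move: (q ^+ k) => x a1 a2 a3 a4 a5 a6 a7 x0.
move=> /andP[h1 h2] /andP[h3 h4] /andP[/andP[h5 h6] h7].
by field; nz; first [nzm y0 h6 | nzm q0 hd | nzm y0 h7 | nzm b0 h4 | nzm y0 hy1].
Qed.

Definition watson_term A B y k :=
  qpoch q A k * qpoch q B k * qpoch (q ^+ 2) y k * q ^+ k
  / (qpoch q q k * qpoch (q ^+ 2) (q * A * B) k * qpoch q y k).

Lemma watson_wz A B y j : q != 0 -> y != 0 ->
  qpoch q q j != 0 -> qpoch (q ^+ 2) (q * A * B) j != 0 ->
  qpoch q (y / q ^+ 2) j.+2 != 0 ->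
  (1 - q / y) * (1 - q * A * B / y)
    * (\sum_(k < j.+1) watson_term A B (y / q ^+ 2) k)
  - (1 - q * A / y) * (1 - q * B / y) * (\sum_(k < j.+1) watson_term A B y k)
  = - (q / y) * watson_term A B y j * (1 - A * q ^+ j) * (1 - B * q ^+ j)
    / q ^+ j.
Proof.
move=> q0 y0 hq hC hD.
pose H k := - (q / y) * watson_term A B y k * (1 - A * q ^+ k) * (1 - B * q ^+ k)
    / q ^+ k.
apply: (@partial_sums _ _ _ _ _ H) => [|k kj].
  by rewrite /H /watson_term /= !qpoch0 !expr0; field; nz.
have {hq} := qpoch_neq0_leq kj hq.
have {hC} := qpoch_neq0_leq kj hC.
have {hD} : qpoch q (y / q ^+ 2) k.+3 != 0 by exact: qpoch_neq0_leq hD.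
rewrite /H /watson_term.
have e1 : y / q ^+ 2 * q ^+ 2 = y by field; nz.
have e2 : y / q ^+ 2 * q = y / q by field; nz.
have e3 : y / q * q = y by field; nz.
rewrite (qpochSl (q ^+ 2) (y / q ^+ 2)) 2!(qpochSl q (y / q ^+ 2)) e1 e2.
rewrite 1!(qpochSl q (y / q) k.+1) e3.
rewrite qpochS !mulf_eq0 !negb_or => /and3P[hy1 hy2 /andP[hy3 hy4]].
have e4 : (1 - y / q) * qpoch q y k = qpoch q (y / q) k * (1 - y / q * q ^+ k).
  by have := qpochSl q (y / q) k; rewrite e3 => <-; rewrite qpochS.
have : qpoch q (y / q) k * (1 - y / q * q ^+ k) != 0 by rewrite -e4 mulf_neq0.
rewrite mulf_eq0 negb_or => /andP[hy5 hy6].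
have -> : qpoch q (y / q) k = (1 - y / q) * qpoch q y k / (1 - y / q * q ^+ k).
  by rewrite e4 mulfK.
move=> {e4 hy5}; move: hy3 hy4 hy6.
rewrite !qpochS -!exprM !(mulnC 2) !exprM !exprS !expr0 !mulr1 !mulf_eq0 !negb_or.
move: (expf_neq0 k q0).
move: (qpoch q y k) (qpoch q A k) (qpoch q B k) (qpoch q q k).
move: (qpoch (q * q) _ k) (qpoch (q * q) _ k).
move: (q ^+ k) => x a1 a2 a3 a4 a5 a6 x0.
move=> h1 h2 h3 /andP[h5 h6] /andP[h7 h8].
by field; nz; first [nzm q0 h3 | nzm q0 hy2 | nzm (expf_neq0 2 q0) hy1].
Qed.
End Creative.

Section TerminatingSums.
Variables (F : fieldType) (q : F).
Implicit Types (x y A B C a b c d : F) (n k j : nat).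

(** Induction on [n] through [vwp_wz] at [j = n.+1]. The denominators contain (d^2 q^n)_k; the
    [n.*2] factors of (d^2) cover these for all smaller [n] as well. *)
Lemma sum_6phi5 b d n : q != 0 -> b != 0 -> d != 0 -> 1 - d ^+ 2 / q != 0 ->
  qpoch q q n != 0 -> qpoch q (d ^+ 2 / b) n != 0 -> qpoch q d n != 0 ->
  qpoch q (d ^+ 2) n.*2 != 0 ->
  \sum_(k < n.+1) vwp_term q b d (q ^- n) k
  = qpoch q (d ^+ 2) n * qpoch q (d / b) n
    / (qpoch q (d ^+ 2 / b) n * qpoch q d n).
Proof.
move=> q0 b0 d0 hd; elim: n => [|n IH] hq hb hd1 hd2.
  by rewrite big_ord1 /vwp_term /vwp_core !qpoch0 !expr0 !mulr1 invr1 !mulr1 expr1n mulr1 divff.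
have N0 : q ^+ n != 0 by rewrite expf_neq0.
have hD : qpoch q (d ^+ 2 / q ^- n) n.+2 != 0.
  rewrite invrK.
  move: hd2; rewrite doubleS -addnn -!addnS qpochD mulf_eq0 negb_or.
  by move=> /andP[].
have := @vwp_wz _ q b d (q ^- n) n.+1 q0 b0 d0 (invr_neq0 N0) hd hq hb hD.
rewrite {3}/vwp_term /vwp_core qpoch_terminates // !(mulr0, mul0r).
rewrite [X in _ - _ * X]big_ord_recr /= {3}/vwp_term /vwp_core qpoch_terminates //.
rewrite !(mulr0, mul0r, addr0).
rewrite IH; [|exact: qpoch_neq0_leq hq|exact: qpoch_neq0_leq hb
  |exact: qpoch_neq0_leq hd1|by apply: qpoch_neq0_leq hd2; rewrite leq_double].
have -> : q ^- n / q = q ^- n.+1 by rewrite exprSr invfM.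
set S := \sum_(k < _) _ => HS.
move: hb hd1; rewrite !qpochS !mulf_eq0 !negb_or.
move=> /andP[hb1 hb2] /andP[hd3 hd4].
have h : (1 - d ^+ 2 / b * q ^+ n) * (1 - d * q ^+ n) != 0 by rewrite mulf_neq0.
have N1 : (q ^- n) ^-1 = q ^+ n by exact: invrK.
apply: (mulfI h); move/eqP: HS; rewrite subr_eq0 => /eqP.
rewrite !invfM !N1 !mulrA => ->.
by field; nz; nzm b0 hb2.
Qed.
Lemma q_watson A B n : q != 0 -> qpoch q q n.*2 != 0 ->
  qpoch (q ^+ 2) q n != 0 -> qpoch (q ^+ 2) (q * A * B) n != 0 ->
  \sum_(k < n.+1) watson_term q A B (q ^- n.*2) k
  = qpoch (q ^+ 2) (q * A) n * qpoch (q ^+ 2) (q * B) n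
    / (qpoch (q ^+ 2) q n * qpoch (q ^+ 2) (q * A * B) n).
Proof.
(* The recurrence from n to n + 1 needs (q^(-2n-2))_(n+3) nonzero, hence n + 3 <= 2n + 2. This fails
   for n = 0, so 0 and 1 are computed directly and the induction starts at 1. *)
move=> q0; case: n => [|n].
  by move=> *; rewrite big_ord1 /watson_term /= !qpoch0 !expr0 !mulr1.
elim: n => [|n IH] hq h1 h2.
  move: hq h1 h2; rewrite !big_ord_recr big_ord0 /watson_term /=.
  rewrite !qpochS !qpoch0 !expr0 !expr1 !mulr1 !mul1r => hq h1 h2.
  have h3 : 1 - q ^- 1.*2 != 0.
    have := @qpoch_neg_neq0 _ q 2 1 q0 isT.
    by rewrite !qpochS !qpoch0 !expr0 !expr1 !mulr1 !mul1r; apply.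
  field; nz.
  by nzm (expf_neq0 2 q0) h3.
have N0 m : q ^+ m != 0 by rewrite expf_neq0.
have e1 : q ^- n.+1.*2 / q ^+ 2 = q ^- n.+2.*2.
  by rewrite -invfM -exprD addn2 -doubleS.
have hD : qpoch q (q ^- n.+1.*2 / q ^+ 2) n.+4 != 0.
  rewrite e1; apply: qpoch_neg_neq0 hq => //.
  by rewrite -addnn !addSn addnS !ltnS leq_addl.
have := @watson_wz _ q A B (q ^- n.+1.*2) n.+2 q0 (invr_neq0 (N0 _)) _ h2 hD.
have hq2 : qpoch q q n.+2 != 0 by apply: qpoch_neq0_leq hq; rewrite -addnn leq_addl.
have y2 : q ^- n.+1.*2 = (q ^+ 2) ^- n.+1 by rewrite -exprM mul2n.
have hz : watson_term q A B (q ^- n.+1.*2) n.+2 = 0.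
  by rewrite /watson_term y2 qpoch_terminates ?expf_neq0 // !(mulr0, mul0r).
rewrite e1 => /(_ hq2); rewrite hz.
rewrite [X in _ - _ * X]big_ord_recr /= hz !(mulr0, mul0r, addr0).
rewrite IH; [|by apply: qpoch_neq0_leq hq; rewrite leq_double
  |exact: qpoch_neq0_leq h1|exact: qpoch_neq0_leq h2].
set S := \sum_(k < _) _ => HS.
move: h1 h2; rewrite !(qpochS _ _ n.+1) !mulf_eq0 !negb_or.
move=> /andP[h1 h3] /andP[h2 h4].
have h : (1 - q * (q ^+ 2) ^+ n.+1) * (1 - q * A * B * (q ^+ 2) ^+ n.+1) != 0.
  by rewrite mulf_neq0.
apply: (mulfI h); move/eqP: HS; rewrite subr_eq0 => /eqP.
rewrite y2 !invrK => ->.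
by field; nz.
Qed.

End TerminatingSums.

(** * Sears' transformation *)

Section Reversal.
Variables (F : fieldType) (q : F).
Implicit Types (x y A B C a b c d : F) (n k j : nat).

(** The factor 1 - q^(i+1)/(x q^n) equals -q^(i+1)/(x q^n) times 1 - x q^(n-1-i), so the first
    product restores the last [k] factors of (x)_n. Without division no factor has to be nonzero. *)
Lemma qpoch_reverse x n k : q != 0 -> x != 0 -> (k <= n)%N ->
  qpoch q (q / (x * q ^+ n)) k * qpoch q x (n - k) * x ^+ k * (q ^+ n) ^+ k
  = qpoch q x n * (-1) ^+ k * q ^+ 'C(k.+1, 2).
Proof.
move=> q0 x0; elim: k => [|k IH] kn.
  by rewrite subn0 qpoch0 !expr0 !mulr1 mul1r.
rewrite binS bin1 exprD !exprS qpochS.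
have N0 m : q ^+ m != 0 by rewrite expf_neq0.
rewrite (_ : _ * (-1 * _) * _
  = - (q * q ^+ k) * (qpoch q x n * (-1) ^+ k * q ^+ 'C(k.+1, 2))); last by ring.
rewrite -IH ?(ltnW kn) //.
have -> : (n - k)%N = (n - k.+1).+1 by rewrite subnSK.
rewrite qpochS.
have -> : q ^+ (n - k.+1) = q ^+ n / (q * q ^+ k).
  by rewrite -exprS -[in RHS](subnK kn) exprD mulfK.
by field; nz.
Qed.

Lemma sum_triangle (g : nat -> nat -> F) n :
  \sum_(k < n.+1) \sum_(j < k.+1) g k j
  = \sum_(j < n.+1) \sum_(i < (n - j).+1) g (j + i)%N j.
Proof.
elim: n => [|n IH]; first by rewrite !big_ord1.
rewrite big_ord_recr /= IH [in RHS]big_ord_recr /= subnn big_ord1 addn0.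
rewrite [\sum_(j < n.+2) _]big_ord_recr /= addrA -big_split /=; congr (_ + _).
apply: eq_bigr => j _; have jn : (j <= n)%N by rewrite -ltnS.
by rewrite subSn // [in RHS]big_ord_recr /= addnS subnKC.
Qed.

Lemma qpoch_reverseE x n k : q != 0 -> x != 0 -> (k <= n)%N ->
  qpoch q x (n - k) != 0 ->
  qpoch q (q / (x * q ^+ n)) k
  = qpoch q x n * (-1) ^+ k * q ^+ 'C(k.+1, 2)
    / (qpoch q x (n - k) * x ^+ k * (q ^+ n) ^+ k).
Proof.
move=> q0 x0 kn h; apply: (canRL (mulfK _)).
  by rewrite !mulf_neq0 ?expf_neq0.
by rewrite !mulrA qpoch_reverse.
Qed.

(* Coefficient form of the q-Pfaff-Saalschuetz sum. *)
Lemma saalschutz_convolution b c d k : q != 0 -> b != 0 -> c != 0 -> d != 0 ->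
  qpoch q q k != 0 -> qpoch q d k != 0 -> qpoch q (b * c / d / q) k.+1 != 0 ->
  qpoch q b k * qpoch q c k / (qpoch q q k * qpoch q d k)
  = \sum_(j < k.+1) qpoch q (d / b) j * qpoch q (d / c) j * (b * c / d) ^+ j
      / (qpoch q q j * qpoch q d j)
      * (qpoch q (b * c / d) (k - j) / qpoch q q (k - j)).
Proof.
move=> q0 b0 c0 d0 hq hd hD.
set D := b * c / d in hD *.
have D0 : D != 0 by rewrite /D !mulf_neq0 ?invr_neq0.
have N0 m : q ^+ m != 0 by rewrite expf_neq0.
have hD1 : qpoch q D k != 0.
  by move: hD; rewrite qpochSl mulfVK // mulf_eq0 negb_or => /andP[].
have hD2 : qpoch q (q / (D * q ^+ k)) k.+1 != 0.
  apply/qpoch_neq0P => i ik.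
  have -> : q / (D * q ^+ k) * q ^+ i = (D / q * q ^+ (k - i))^-1.
    have -> : q ^+ k = q ^+ (k - i) * q ^+ i by rewrite -exprD subnK.
    by field; nz.
  by apply: inv_neq1; move/qpoch_neq0P: hD; apply; rewrite ltnS leq_subr.
have db0 : d / b != 0 by rewrite mulf_neq0 ?invr_neq0.
have dc0 : d / c != 0 by rewrite mulf_neq0 ?invr_neq0.
have := @q_saalschutz _ q (d / b) (d / c) d k q0 db0 dc0 d0 hq hd.
have e1 : d / b * (d / c) * q / (d * q ^+ k) = q / (D * q ^+ k).
  by rewrite /D; field; nz.
have e2 : d / c * q / (d * q ^+ k) = q / (c * q ^+ k) by field; nz.
have e3 : d / (d / b) = b by field; nz.
rewrite e1 e2 e3 => /(_ hD2) HS.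
have hD3 : qpoch q (q / (D * q ^+ k)) k != 0 by exact: qpoch_neq0_leq hD2.
(* Reversing (D)_(k-j) and (q)_(k-j) turns the convolution into a Saalschuetz sum with y = q^-k, up
   to the factor (D)_k / (q)_k. *)
have -> : qpoch q b k * qpoch q c k / (qpoch q q k * qpoch q d k)
  = qpoch q D k / qpoch q q k * \sum_(k0 < k.+1) saalschutz_term q (d / b) (d / c) d (q ^- k) k0.
  rewrite HS.
  have sg : (-1) ^+ k != 0 :> F by rewrite signr_eq0.
  rewrite !qpoch_reverseE ?subnn ?qpoch0 ?oner_neq0 //.
  have -> : D ^+ k = c ^+ k * b ^+ k / d ^+ k by rewrite /D expr_div_n exprMn [b ^+ k * _]mulrC.
  rewrite expr_div_n; field; nz; exact: expf_neq0.
rewrite mulr_sumr; apply: eq_bigr => j _.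
have jk : (j <= k)%N by rewrite -ltnS.
rewrite /saalschutz_term.
have e4 : d / b * (d / c) * q * q ^- k / d = q / (D * q ^+ k).
  by rewrite /D; field; nz.
rewrite e4.
have hqj : qpoch q q (k - j) != 0 by apply: qpoch_neq0_leq hq; exact: leq_subr.
have hDj : qpoch q D (k - j) != 0 by apply: qpoch_neq0_leq hD1; exact: leq_subr.
have hqj' := qpoch_neq0_leq jk hq.
have hdj' := qpoch_neq0_leq jk hd.
have sg : (-1) ^+ j != 0 :> F by rewrite signr_eq0.
(* Puts (q^-k)_j into the shape reversed by [qpoch_reverseE], with x = q. *)
have -> : q ^- k = q / (q * q ^+ k) by field; nz.
rewrite !qpoch_reverseE //; field; nz; exact: expf_neq0.
Qed.
End Reversal.

Section Sears.
Variables (F : fieldType) (q : F).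
Implicit Types (x y A B C a b c d : F) (n k j : nat).

Lemma qpochs_cons x xs n : qpochs q (x :: xs) n = qpoch q x n * qpochs q xs n.
Proof. exact: big_cons. Qed.

Lemma qpochs_nil n : qpochs q [::] n = 1.
Proof. exact: big_nil. Qed.

Definition qpochsE := (qpochs_cons, qpochs_nil, mulr1).

(** [saalschutz_convolution] expands (b, c)_k / (q, d)_k over j; after exchanging the sums, the sum
    over k is again balanced and [q_saalschutz] evaluates it. The last two parameters on the right
    are a q^(1-n)/e and a q^(1-n)/f, written in the form that [qpoch_reverse] produces. *)
Lemma sears_transformation a b c d e f n : q != 0 -> a != 0 -> b != 0 -> c != 0 -> d != 0 ->
  e != 0 -> f != 0 -> d * e * f * q ^+ n = a * b * c * q ->
  qpoch q q n != 0 -> qpoch q d n != 0 -> qpoch q e n != 0 ->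
  qpoch q f n.+1 != 0 -> qpoch q (b * c / d / q) n.+1 != 0 ->
  qpoch q (e / a) n != 0 -> qpoch q (f / a) n != 0 ->
  phi43 n q a b (q ^- n) c d e f q
  = qpoch q (e / a) n * qpoch q (f / a) n * a ^+ n / (qpoch q e n * qpoch q f n)
    * phi43 n q a (d / b) (q ^- n) (d / c) d
        (q / (e / a * q ^+ n)) (q / (f / a * q ^+ n)) q.
Proof.
move=> q0 a0 b0 c0 d0 e0 f0 bal hq hd he hf hD hea hfa.
have N0 m : q ^+ m != 0 by rewrite expf_neq0.
set D := b * c / d in hD *.
have D0 : D != 0 by rewrite /D !mulf_neq0 ?invr_neq0.
have fE : f = a * D * q / (e * q ^+ n).
  have h := mulf_neq0 (mulf_neq0 d0 e0) (N0 n).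
  apply: (mulIf h); rewrite (_ : f * _ = d * e * f * q ^+ n); last by ring.
  by rewrite bal /D; field; nz.
pose u j := qpoch q (d / b) j * qpoch q (d / c) j * D ^+ j
   / (qpoch q q j * qpoch q d j).
pose v j := qpoch q D j / qpoch q q j.
pose A k := qpoch q a k * qpoch q (q ^- n) k * q ^+ k / (qpoch q e k * qpoch q f k).
pose g k j := A k * (u j * v (k - j)%N).
have -> : phi43 n q a b (q ^- n) c d e f q = \sum_(k < n.+1) \sum_(j < k.+1) g k j.
  apply: eq_bigr => k _; rewrite -mulr_sumr.
  have kn : (k <= n)%N by rewrite -ltnS.
  have hqk := qpoch_neq0_leq kn hq; have hdk := qpoch_neq0_leq kn hd.
  have hek := qpoch_neq0_leq kn he; have hfk := qpoch_neq0_leq (leqW kn) hf.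
  have hDk : qpoch q (D / q) k.+1 != 0 by exact: qpoch_neq0_leq hD.
  rewrite /u /v /D -saalschutz_convolution //.
  by rewrite /A !qpochsE; field; nz.
rewrite sum_triangle [RHS]mulr_sumr; apply: eq_bigr => -[j jlt] _ /=.
have jn : (j <= n)%N by rewrite -ltnS.
have hfn : qpoch q f n != 0 by exact: qpoch_neq0_leq hf.
have hqj := qpoch_neq0_leq jn hq; have hdj := qpoch_neq0_leq jn hd.
have hej := qpoch_neq0_leq jn he; have hfj := qpoch_neq0_leq jn hfn.
have hqi : qpoch q q (n - j) != 0 by apply: qpoch_neq0_leq hq; exact: leq_subr.
have split x : qpoch q x n = qpoch q x j * qpoch q (x * q ^+ j) (n - j).
  by rewrite -qpochD subnKC.
have hei : qpoch q (e * q ^+ j) (n - j) != 0.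
  by move: he; rewrite split mulf_eq0 negb_or => /andP[].
have hfi : qpoch q (f * q ^+ j) (n - j).+1 != 0.
  have en : n.+1 = (j + (n - j).+1)%N by rewrite addnS subnKC.
  by move: hf; rewrite en qpochD mulf_eq0 negb_or => /andP[].
have Nj : q ^+ n = q ^+ j * q ^+ (n - j) by rewrite -exprD subnKC.
have e1 : a * q ^+ j * D * q / (e * q ^+ j * q ^+ (n - j)) = f * q ^+ j.
  by rewrite fE Nj; field; nz.
have e2 : D * q / (e * q ^+ j * q ^+ (n - j)) = f / a.
  by rewrite fE Nj; field; nz.
have e3 : e * q ^+ j / (a * q ^+ j) = e / a by field; nz.
have e4 : a * q ^+ j * D * q * q ^- (n - j) / (e * q ^+ j) = f * q ^+ j.
  by rewrite -e1; field; nz.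
have := @q_saalschutz _ q (a * q ^+ j) D (e * q ^+ j) (n - j) q0
  (mulf_neq0 a0 (N0 j)) D0 (mulf_neq0 e0 (N0 j)) hqi hei.
rewrite e1 e2 e3 => /(_ hfi) HS.
(* With k = j + i, all products shift by [j], and the inner sum is a Saalschuetz sum of length n -
   j. *)
have -> : \sum_(i < (n - j).+1) g (j + i)%N j = u j * A j
   * \sum_(k < (n - j).+1) saalschutz_term q (a * q ^+ j) D (e * q ^+ j) (q ^- (n - j)) k.
  rewrite mulr_sumr; apply: eq_bigr => i _.
  rewrite /g /v /saalschutz_term e4 addKn /A !qpochD exprD.
  have -> : q ^- n * q ^+ j = q ^- (n - j) by rewrite Nj; field; nz.
  have ij : (i <= n - j)%N by rewrite -ltnS.
  have h1 := qpoch_neq0_leq ij hqi; have h2 := qpoch_neq0_leq ij hei.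
  have h3 := qpoch_neq0_leq (leqW ij) hfi.
  by field; nz.
rewrite HS !qpochsE.
have sg : (-1) ^+ j != 0 :> F by rewrite signr_eq0.
have ea0 : e / a != 0 by rewrite mulf_neq0 ?invr_neq0.
have fa0 : f / a != 0 by rewrite mulf_neq0 ?invr_neq0.
have hea' : qpoch q (e / a) (n - j) != 0 by apply: qpoch_neq0_leq hea; exact: leq_subr.
have hfa' : qpoch q (f / a) (n - j) != 0 by apply: qpoch_neq0_leq hfa; exact: leq_subr.
rewrite !qpoch_reverseE // /u /A (split e) (split f).
have hfi' : qpoch q (f * q ^+ j) (n - j) != 0 by exact: qpoch_neq0_leq hfi.
have tt : (q ^+ 'C(j.+1, 2)) ^+ 2 = (q ^+ j) ^+ j * q ^+ j.
  by rewrite -!exprM -exprD mulnC -mul_bin_diag bin1 mulSn addnC.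
have aq0 : (a * q ^+ j) ^+ (n - j) != 0 by rewrite expf_neq0 // mulf_neq0.
have ss : ((-1) ^+ j) ^+ 2 = 1 :> F by rewrite sqrr_sign.
(* Accounts for the monomials left by the reversals: the balancing condition gives D = e f q^n / (a
   q), and [tt] evaluates the squared binomial power. *)
have -> : D ^+ j = a ^+ n * (e / a) ^+ j * (f / a) ^+ j * ((q ^+ n) ^+ j) ^+ 2
    / ((a * q ^+ j) ^+ (n - j) * ((-1) ^+ j * q ^+ 'C(j.+1, 2)) ^+ 2).
  apply: (canRL (mulfK _)); first by rewrite mulf_neq0 // expf_neq0 // mulf_neq0.
  have -> : D = f * e * q ^+ n / (a * q) by rewrite fE; field; nz.
  rewrite !exprMn tt ss !exprVn !exprMn.
  have -> : a ^+ n = a ^+ j * a ^+ (n - j) by rewrite -exprD subnKC.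
  have -> : (q ^+ n) ^+ j = (q ^+ j) ^+ j * (q ^+ j) ^+ (n - j).
    by rewrite -exprD subnKC // -!exprM mulnC.
  by field; nz; exact: expf_neq0.
by field; nz; exact: expf_neq0.
Qed.
End Sears.

(** * Expansions in shifted parameters *)

Section Expansion.
Variables (F : fieldType) (q : F).
Implicit Types (x y A B C a b c d : F) (n k j : nat).

Lemma qpoch_sqr x n :
  qpoch (q ^+ 2) (x ^+ 2) n = qpoch q x n * qpoch q (- x) n.
Proof.
elim: n => [|n IH]; first by rewrite !qpoch0 mulr1.
by rewrite !qpochS IH -!exprM mulnC exprM; ring.
Qed.

Lemma sum_shift (f : nat -> F) n j : (j <= n)%N ->
  \sum_(k < n.+1) (if (j <= k)%N then f k else 0)
  = \sum_(i < (n - j).+1) f (j + i)%N.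
Proof.
move=> jn; have -> : n.+1 = (j + (n - j).+1)%N by rewrite addnS subnKC.
rewrite big_split_ord /= big1 ?add0r => [|i _]; last by rewrite leqNgt ltn_ord.
by apply: eq_bigr => i _; rewrite leq_addr.
Qed.

(** Factors of T_{i,j} that come from the second 6phi5 sum; they involve neither i nor a and c. *)
Definition contig_coef m n j :=
  (-1) ^+ j * q ^+ 'C(j.+1, 2) / (q ^+ n) ^+ j
  * (qpoch q (q ^- m) j / (qpoch q q j * qpoch q (q ^- (m + n + n)) j
     * qpoch q (q ^+ j / (q ^+ (m + n).*2 * q)) j)).

(** This is [sum_6phi5] with b = q^-k, d = q^-M and length [m]. The term j is a Watson denominator
    for M - j at index k - j. Terms with j > k vanish through (q^-k)_j, whence the conditional. *)
Lemma contig_expansion m n k : q != 0 -> (forall i, qpoch q q i != 0) ->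
  (k <= m + n)%N ->
  qpoch q (q ^- n) k
    / (qpoch q q k * qpoch q (q ^- (m + n + n)) k * qpoch q (q ^- (m + n)) k)
  = \sum_(j < m.+1) (if (j <= k)%N then
      contig_coef m n j / q ^+ j
        / (qpoch q q (k - j) * qpoch q (q ^- (m + n - j).*2) (k - j)) else 0).
Proof.
move=> q0 hq; set M := (m + n)%N => kM.
have N0 i : q ^+ i != 0 by rewrite expf_neq0.
have mM : (m <= M)%N by exact: leq_addr.
have ng s t : (t <= s)%N -> qpoch q (q ^- s) t != 0.
  by move=> ts; apply: qpoch_neg_neq0 (hq s).
have ngE s t u x : (t + u <= s)%N -> x = q ^+ u / q ^+ s -> qpoch q x t != 0.
  move=> tus ->; rewrite -(subnK (leq_trans (leq_addl t u) tus)) exprD invfM.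
  by rewrite mulrCA mulfV // mulr1 ng // -(leq_add2r u) subnK // (leq_trans _ tus) ?leq_addl.
have Mm2 : (m.*2 <= M.*2)%N by rewrite leq_double.
have X2 : (q ^- M) ^+ 2 = q ^- M.*2 by rewrite exprVn -exprM muln2.
have hd1 : 1 - (q ^- M) ^+ 2 / q != 0.
  have := @ngE M.*2.+1 1%N 0%N (q ^- M.*2 / q) isT.
  rewrite qpochS qpoch0 mul1r mulr1 X2; apply.
  by rewrite exprS mul1r invfM mulrC.
have e1 : (q ^- M) ^+ 2 / q ^- k = q ^+ k / q ^+ M.*2 by rewrite X2 invrK mulrC.
have h2 : qpoch q ((q ^- M) ^+ 2 / q ^- k) m != 0.
  by apply: (ngE M.*2 m k) e1; rewrite -addnn leq_add.
have h4 : qpoch q ((q ^- M) ^+ 2) m.*2 != 0.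
  by rewrite X2; exact: ng.
have := @sum_6phi5 _ q (q ^- k) (q ^- M) m q0 (invr_neq0 (N0 k)) (invr_neq0 (N0 M))
  hd1 (hq m) h2 (ng M m mM) h4.
have e2 : q ^- M / q ^- k = q ^+ k / q ^+ M by rewrite invrK mulrC.
rewrite e1 e2 X2 => HS.
(* Splitting a product of k + m factors in both orders trades ratios of length [m] for ratios of
   length [k]. *)
have := qpochD q (q ^- M.*2) k m; rewrite addnC qpochD => c1.
have := qpochD q (q ^- M) k m; rewrite addnC qpochD => c2.
have e3 : q ^- M.*2 * q ^+ m = q ^- (M + n).
  have -> : q ^+ M.*2 = q ^+ (M + n) * q ^+ m by rewrite -exprD -addnA [(n + m)%N]addnC -/M addnn.
  by field; nz.
have e4 : q ^- M * q ^+ m = q ^- n.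
  by rewrite /M exprD; field; nz.
have e5 s : q ^- s * q ^+ k = q ^+ k / q ^+ s by rewrite mulrC.
rewrite e3 e5 in c1; rewrite e4 e5 in c2.
rewrite e1 in h2.
have h5 : qpoch q (q ^- (M + n)) k != 0.
  by apply: ng; exact: leq_trans kM (leq_addr _ _).
have h6 := ng M k kM; have h7 := ng M m mM.
have h8 : qpoch q (q ^- M.*2) k != 0 by rewrite ng // -addnn (leq_trans kM) ?leq_addr.
have -> : qpoch q (q ^- n) k
    / (qpoch q q k * qpoch q (q ^- (M + n)) k * qpoch q (q ^- M) k)
   = (qpoch q q k * qpoch q (q ^- M.*2) k)^-1
     * \sum_(j < m.+1) vwp_term q (q ^- k) (q ^- M) (q ^- m) j.
  rewrite HS.
  have -> : qpoch q (q ^- M.*2) m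
    = qpoch q (q ^- M.*2) k * qpoch q (q ^+ k / q ^+ M.*2) m / qpoch q (q ^- (M + n)) k.
    by rewrite -c1 mulfK.
  have -> : qpoch q (q ^+ k / q ^+ M) m
    = qpoch q (q ^- M) m * qpoch q (q ^- n) k / qpoch q (q ^- M) k.
    by rewrite c2 mulrAC divff // mul1r.
  by have hk := hq k; field; nz.
rewrite mulr_sumr; apply: eq_bigr => -[j jlt] _ /=.
have jm : (j <= m)%N by [].
case: leqP => [jk|kj]; last first.
  by rewrite /vwp_term /vwp_core (qpoch_terminates q0 kj) !(mulr0, mul0r).
rewrite /vwp_term /vwp_core X2 /contig_coef -/M.
set X := q ^- M.*2; set a := X / q.
have jM : (j <= M)%N by exact: leq_trans jm mM.
have aE : a * q = X by rewrite mulfVK.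
have aj : q ^+ j / (q ^+ M.*2 * q) = a * q ^+ j by rewrite /a /X; field; nz.
have Xk : X / q ^- k = X * q ^+ k by rewrite invrK.
have Xm : X / q ^- m = q ^- (M + n) by rewrite invrK e3.
have Xj : q ^- (M - j).*2 = X * q ^+ j.*2.
  by rewrite /X -[in RHS](subnK jM) doubleD exprD; field; nz; exact: N0.
have kq : q ^- M / (q ^- k * q ^- m) = q ^+ k / q ^+ n.
  by rewrite /M exprD; field; nz.
rewrite aj Xk Xm Xj kq expr_div_n.
(* The very-well-poised factor extends (a)_(2j) to (a)_(2j+1); removing the first factor instead
   leaves (aq)_(2j). *)
have A1 : qpoch q a j * qpoch q (a * q ^+ j) j * (1 - a * (q ^+ j) ^+ 2)
    = (1 - a) * qpoch q X j.*2.
  by rewrite -qpochD -exprM muln2 -addnn -qpochS qpochSl aE.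
have A2 : qpoch q X j.*2 * qpoch q (X * q ^+ j.*2) (k - j)
    = qpoch q X k * qpoch q (X * q ^+ k) j.
  by rewrite -!qpochD -addnn -addnA subnKC // addnC.
have A3 := @qpoch_reverseE _ q q k j q0 q0 jk (hq _).
rewrite (_ : q / (q * q ^+ k) = q ^- k) in A3; last by field; nz.
rewrite A3.
have j2 : (j + j <= M.*2)%N by rewrite -addnn leq_add.
have n1 : qpoch q a j != 0.
  apply: (@ngE M.*2.+1 j 0%N) => //.
    by rewrite addn0 ltnW // ltnS -[j]addn0 (leq_trans _ j2) // leq_add2l.
  by rewrite /a /X exprS mul1r invfM mulrC.
have n2 : qpoch q (a * q ^+ j) j != 0.
  apply: (@ngE M.*2.+1 j j); first exact: leqW.
  by rewrite /a /X exprS; field; nz.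
have n3 : qpoch q (X * q ^+ j.*2) (k - j) != 0.
  rewrite -Xj ng // -addnn (leq_trans (leq_sub2r j kM)) ?leq_addl //.
have n4 : qpoch q (X * q ^+ k) j != 0.
  by move: h2; rewrite mulrC; exact: qpoch_neq0_leq.
have n5 : qpoch q (q ^- (M + n)) j != 0.
  by apply: ng; exact: leq_trans jM (leq_addr _ _).
have n6 : 1 - a != 0 by rewrite /a /X -X2.
have hk := hq k; have hj := hq j; have hkj := hq (k - j)%N.
have -> : (1 - a * (q ^+ j) ^+ 2) / (1 - a)
    = qpoch q X k * qpoch q (X * q ^+ k) j / qpoch q (X * q ^+ j.*2) (k - j)
      / (qpoch q a j * qpoch q (a * q ^+ j) j).
  rewrite -A2 mulfK //; apply/eqP; rewrite eqr_div ?mulf_neq0 //.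
  by rewrite mulrC A1 mulrC.
have Q1 : (q ^+ k) ^+ j != 0 by rewrite expf_neq0.
have Q2 : (q ^+ n) ^+ j != 0 by rewrite expf_neq0.
have Q3 := N0 j.
move: n1 n2 n3 n4 n5 n6 hk hj hkj Q1 Q2 Q3 h8.
rewrite -/X -/a.
move: (qpoch q a j) (qpoch q (a * _) j) (qpoch q (X * _) (k - j)).
move: (qpoch q (X * _) j) (qpoch q (q ^- (M + n)) j) (qpoch q q k).
move: (qpoch q q j) (qpoch q q (k - j)) ((q ^+ k) ^+ j) ((q ^+ n) ^+ j) (q ^+ j) (qpoch q X k) => *.
by field; nz.
Qed.
End Expansion.

(** * The q-Watson sum with shifted parameters *)

Section ContiguousWatson.
Variables (F : fieldType) (q : F).
Implicit Types (x y A B C a b c d : F) (n k j : nat).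

(** After [contig_expansion] and the substitution k = j + i, the inner sum is [q_watson] of length M
    - j with parameters A q^j and B q^j. The case m = 0 is the unshifted sum. *)
Lemma q_watson_contiguous A B m n : q != 0 -> (forall i, qpoch q q i != 0) ->
  (forall i, qpoch (q ^+ 2) (q * A * B) i != 0) ->
  \sum_(k < n.+1) qpoch q (q ^- n) k * qpoch q A k * qpoch q B k
      * qpoch q (- q ^- (m + n)) k * q ^+ k
    / (qpoch q q k * qpoch (q ^+ 2) (q * A * B) k * qpoch q (q ^- (m + n + n)) k)
  = \sum_(j < m.+1) contig_coef q m n j
      * (qpoch q (q ^- (m + n)) j * qpoch q (- q ^- (m + n)) j
         * qpoch q A j * qpoch q B j / qpoch (q ^+ 2) (q * A * B) j)
      * (qpoch (q ^+ 2) (q * (A * q ^+ j)) (m + n - j)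
         * qpoch (q ^+ 2) (q * (B * q ^+ j)) (m + n - j)
         / (qpoch (q ^+ 2) q (m + n - j)
            * qpoch (q ^+ 2) (q * (A * q ^+ j) * (B * q ^+ j)) (m + n - j))).
Proof.
move=> q0 hq hAB; set M := (m + n)%N.
have N0 i : q ^+ i != 0 by rewrite expf_neq0.
have ng s t : (t <= s)%N -> qpoch q (q ^- s) t != 0.
  by move=> ts; apply: qpoch_neg_neq0 (hq s).
have hq2 i : qpoch (q ^+ 2) q i != 0.
  apply/qpoch_neq0P => k _; rewrite -exprM.
  by have /qpoch_neq0P/(_ (2 * k)%N (ltnSn _)) := hq (2 * k).+1.
pose stuff k := qpoch (q ^+ 2) (q ^- M.*2) k * qpoch q A k * qpoch q B k * q ^+ k
  / qpoch (q ^+ 2) (q * A * B) k.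
pose f k := stuff k * (qpoch q (q ^- n) k
    / (qpoch q q k * qpoch q (q ^- (M + n)) k * qpoch q (q ^- M) k)).
have X2 : q ^- M.*2 = (q ^- M) ^+ 2 by rewrite exprVn -exprM muln2.
(* The range grows from n to M at no cost, since (q^-n)_k = 0 for k > n; and (q^-M)_k (-q^-M)_k
   becomes (q^-2M; q^2)_k. *)
transitivity (\sum_(k < M.+1) f k).
  rewrite (_ : M.+1 = (n.+1 + m)%N); last by rewrite addSn addnC.
  rewrite big_split_ord /= [X in _ + X]big1 ?addr0 => [|i _]; last first.
    by rewrite /f qpoch_terminates ?mul0r ?mulr0 // leq_addr.
  apply: eq_bigr => -[k klt] _ /=; rewrite /f /stuff X2 qpoch_sqr.
  have kn : (k <= n)%N by [].
  have h1 := hq k; have h2 := hAB k.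
  have h3 : qpoch q (q ^- M) k != 0 by apply/ng/(leq_trans kn)/leq_addl.
  have h4 : qpoch q (q ^- (M + n)) k != 0 by apply/ng/(leq_trans kn)/leq_addl.
  by field; nz.
pose h k j := stuff k * (contig_coef q m n j / q ^+ j
        / (qpoch q q (k - j) * qpoch q (q ^- (M - j).*2) (k - j))).
transitivity (\sum_(j < m.+1) \sum_(k < M.+1) (if (j <= k)%N then h k j else 0)).
  rewrite exchange_big; apply: eq_bigr => -[k klt] _ /=.
  rewrite /f contig_expansion // mulr_sumr; apply: eq_bigr => j _.
  by case: ifP; rewrite ?mulr0.
apply: eq_bigr => -[j jlt] _ /=.
have jM : (j <= M)%N by exact: leq_trans (leq_addr _ _).
rewrite (sum_shift (h^~ j)) //.
have E1 : q * (A * q ^+ j) * (B * q ^+ j) = q * A * B * (q ^+ 2) ^+ j.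
  by rewrite -exprM mulnC exprM; ring.
rewrite -q_watson ?E1 //; last first.
  by have := hAB (j + (M - j))%N; rewrite qpochD mulf_eq0 negb_or => /andP[].
rewrite mulr_sumr; apply: eq_bigr => -[i ilt] _ /=.
rewrite /h /stuff /watson_term addKn -qpoch_sqr -X2 !qpochD exprD.
have -> : q ^- M.*2 * (q ^+ 2) ^+ j = q ^- (M - j).*2.
  rewrite -exprM mul2n -[in M.*2](subnK jM) doubleD exprD.
  by field; nz; exact: N0.
rewrite E1.
have h1 := hAB (j + i)%N; have h2 := hq i.
have h3 : qpoch q (q ^- (M - j).*2) i != 0.
  by apply: ng; rewrite -addnn (leq_trans _ (leq_addl _ _)).
move: h1; rewrite qpochD mulf_eq0 negb_or => /andP[h4 h5].
have h6 := N0 j.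
by field; nz.
Qed.
End ContiguousWatson.

(** * Connection coefficients between shifted products *)

Section Connection.
Variables (F : fieldType) (q : F).
Implicit Types (x y A B C a b c d : F) (n k j : nat).

(** Multiplicative independence: with natural exponents on both sides, relations with negative
    powers are covered after clearing denominators. *)
Definition indep q a c := forall i j k i' j' k' : nat,
  q ^+ i * a ^+ j * c ^+ k = q ^+ i' * a ^+ j' * c ^+ k' ->
  [/\ i = i', j = j' & k = k'].

Variables (a c : F).
Hypotheses (q0 : q != 0) (a0 : a != 0) (c0 : c != 0) (gen : indep q a c).

Lemma indep_qpoch_q n : qpoch q q n != 0.
Proof.
apply/qpoch_neq0P => k _; rewrite subr_eq0 -exprS; apply/eqP => h.
have [] // := gen (i := k.+1) (j := 0) (k := 0) (i' := 0) (j' := 0) (k' := 0).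
by rewrite -h !expr0 !mulr1.
Qed.

(* Squaring covers the parameters of either sign at once. *)
Lemma indep_qpoch x n (i j k i' j' k' : nat) : (j != j') || (k != k') ->
  x ^+ 2 * (q ^+ i * a ^+ j * c ^+ k) = q ^+ i' * a ^+ j' * c ^+ k' ->
  qpoch q x n != 0.
Proof.
move=> jk h; apply/qpoch_neq0P => s _; rewrite subr_eq0; apply/eqP => xs.
have [|_ ej ek] := gen (i := i) (j := j) (k := k)
    (i' := (i' + (s + s))%N) (j' := j') (k' := k').
  rewrite !exprD -[LHS]mul1r -[X in X * _](expr1n _ 2) xs exprMn expr2.
  rewrite (_ : q ^+ i' * _ * _ * _ = q ^+ i' * a ^+ j' * c ^+ k' * (q ^+ s * q ^+ s)).
    by rewrite -h; ring.
  by ring.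
by move: jk; rewrite ej ek !eqxx.
Qed.

Definition connection_coef l i :=
  (q ^+ l) ^+ i * (c / a) ^+ i
  * ((1 - q * (q ^+ i) ^+ 2 / (q ^+ l) ^+ 2 / c ^+ 2)
     / (1 - q / (q ^+ l) ^+ 2 / c ^+ 2))
  * (qpoch q (q ^- l) i * qpoch q (q / q ^+ l * a / c ^+ 2) i
       * qpoch q (q / (q ^+ l) ^+ 2 / c ^+ 2) i
     / (qpoch q q i * qpoch q (q / q ^+ l / a) i
        * qpoch q (q ^+ 2 / q ^+ l / c ^+ 2) i)).

Lemma connection l k :
  qpoch q a k * qpoch q (q / q ^+ l * a / c ^+ 2) k / qpoch q (q / q ^+ l * a / c) k
  = qpoch q a l * qpoch q c l
      / (qpoch q (q ^+ l / q * c ^+ 2) l * qpoch q (q / q ^+ l * a / c) l)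
    * \sum_(i < l.+1) connection_coef l i
      * (qpoch q (q ^+ (l - i) * a) k
         * qpoch q (q / q ^+ l * q ^+ i * a / c ^+ 2) k / qpoch q (q * a / c) k).
Proof.
have N0 i : q ^+ i != 0 by rewrite expf_neq0.
have hq := indep_qpoch_q.
(* With d = q^(1-l)/c the very-well-poised parameter d^2/q is q^(1-2l)/c^2, as in T_{i,j}. The index
   [k] enters the 6phi5 sum only through [b]. *)
pose u := q / q ^+ l * a / c ^+ 2.
pose b := u * q ^+ k.
pose d := q / (c * q ^+ l).
have u0 : u != 0 by rewrite !mulf_neq0 ?invr_neq0 ?expf_neq0.
have b0 : b != 0 by rewrite mulf_neq0.
have d0 : d != 0 by rewrite !mulf_neq0 ?invr_neq0 ?mulf_neq0.
have n1 s : qpoch q (d ^+ 2) s != 0.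
  apply: (@indep_qpoch _ _ (l + l + l + l) 0 4 4 0 0) => //.
  by rewrite /d !exprD; field; nz.
have n2 : 1 - d ^+ 2 / q != 0.
  have : qpoch q (d ^+ 2 / q) 1 != 0.
    apply: (@indep_qpoch _ _ (l + l + l + l) 0 4 2 0 0) => //.
    by rewrite /d !exprD; field; nz.
  by rewrite qpochS qpoch0 expr0 mulr1 mul1r.
have n3 s : qpoch q (d ^+ 2 / b) s != 0.
  apply: (@indep_qpoch _ _ (l + k + l + k) 2 0 2 0 0) => //.
  by rewrite /d /b /u !exprD; field; nz.
have n4 s : qpoch q d s != 0.
  apply: (@indep_qpoch _ _ (l + l) 0 2 2 0 0) => //.
  by rewrite /d !exprD; field; nz.
have HS := sum_6phi5 q0 b0 d0 n2 (hq l) (n3 l) (n4 l) (n1 _).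
have n5 s t : qpoch q (a * q ^+ s) t != 0.
  apply: (@indep_qpoch _ _ 0 0 0 (s + s) 2 0) => //.
  by rewrite !exprD; field; nz.
have n6 t : qpoch q a t != 0.
  by have := n5 0%N t; rewrite expr0 mulr1.
have n7 t : qpoch q c t != 0.
  by apply: (@indep_qpoch _ _ 0 0 0 0 0 2) => //; field; nz.
have n8 s t : qpoch q (q / q ^+ l * a / c * q ^+ s) t != 0.
  apply: (@indep_qpoch _ _ (l + l) 0 2 (s + s + 2) 2 0) => //.
  by rewrite !exprD; field; nz.
have n8' t : qpoch q (q / q ^+ l * a / c) t != 0.
  by have := n8 0%N t; rewrite expr0 mulr1.
have n9 t : qpoch q (q ^+ l / q * c ^+ 2) t != 0.
  apply: (@indep_qpoch _ _ 2 0 0 (l + l) 0 4) => //.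
  by rewrite !exprD; field; nz.
have n10 t : qpoch q (q * a / c) t != 0.
  apply: (@indep_qpoch _ _ 0 0 2 2 2 0) => //.
  by field; nz.
have n11 s t : qpoch q (u * q ^+ s) t != 0.
  apply: (@indep_qpoch _ _ (l + l) 0 4 (s + s + 2) 2 0) => //.
  by rewrite /u !exprD; field; nz.
pose p := q / q ^+ l * a / c.
pose cc := q ^+ l / q * c ^+ 2.
have sg : (-1) ^+ l != 0 :> F by rewrite signr_eq0.
have p0 : p != 0 by rewrite !mulf_neq0 ?invr_neq0.
have cc0 : cc != 0 by rewrite !mulf_neq0 ?invr_neq0.
have HR : \sum_(i < l.+1) vwp_term q b d (q ^- l) i
    = qpoch q cc l * qpoch q (p * q ^+ k) l / (qpoch q (a * q ^+ k) l * qpoch q c l).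
  rewrite HS.
  have -> : d ^+ 2 = q / (cc * q ^+ l) by rewrite /d /cc; field; nz.
  have -> : q / (cc * q ^+ l) / b = q / (a * q ^+ k * q ^+ l).
    by rewrite /cc /b /u; field; nz.
  have -> : d / b = q / (p * q ^+ k * q ^+ l).
    by rewrite /d /b /u /p; field; nz.
  have ak0 : a * q ^+ k != 0 by rewrite mulf_neq0.
  have pk0 : p * q ^+ k != 0 by rewrite mulf_neq0.
  rewrite /d !qpoch_reverseE ?subnn ?qpoch0 ?oner_neq0 //.
  (* Matches the powers left by the four reversals, since cc p = a c. *)
  have -> : c ^+ l = (cc * (p * q ^+ k)) ^+ l / (a * q ^+ k) ^+ l.
    apply: (canRL (mulfK _)); rewrite ?expf_neq0 // -exprMn.
    by congr (_ ^+ l); rewrite /cc /p; field; nz.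
  rewrite (exprMn _ cc); have h1 := n5 k l; have h2 := n7 l.
  by field; nz; exact: expf_neq0.
have c1 : qpoch q (a * q ^+ k) l = qpoch q a l * qpoch q (a * q ^+ l) k / qpoch q a k.
  by apply: (canRL (mulfK _)); rewrite // mulrC -!qpochD addnC.
have c2 : qpoch q (p * q ^+ k) l = qpoch q p l * qpoch q (q * a / c) k / qpoch q p k.
  apply: (canRL (mulfK _)); first exact: n8'.
  rewrite mulrC -qpochD addnC qpochD; congr (_ * qpoch q _ k).
  by rewrite /p; field; nz.
have -> : \sum_(i < l.+1) connection_coef l i
      * (qpoch q (q ^+ (l - i) * a) k
         * qpoch q (q / q ^+ l * q ^+ i * a / c ^+ 2) k / qpoch q (q * a / c) k)
  = qpoch q u k * qpoch q (a * q ^+ l) k / qpoch q (q * a / c) k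
    * \sum_(i < l.+1) vwp_term q b d (q ^- l) i; last first.
  rewrite HR c1 c2 -/u -/p -/cc.
  have h1 := n6 k; have h2 := n6 l; have h3 := n7 l; have h4 := n8' k.
  have h5 := n8' l; have h6 := n9 l; have h7 := n10 k; have h8 := n5 l k.
  by field; nz.
rewrite mulr_sumr; apply: eq_bigr => -[i ilt] _ /=.
have il : (i <= l)%N by [].
rewrite /connection_coef /vwp_term /vwp_core.
have e1 : q / (q ^+ l) ^+ 2 / c ^+ 2 = d ^+ 2 / q by rewrite /d; field; nz.
have e2 : q * (q ^+ i) ^+ 2 / (q ^+ l) ^+ 2 / c ^+ 2 = d ^+ 2 / q * (q ^+ i) ^+ 2.
  by rewrite /d; field; nz.
have e3 : d ^+ 2 / q ^- l = q ^+ 2 / q ^+ l / c ^+ 2.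
  by rewrite /d; field; nz.
have e4 : q / q ^+ l * q ^+ i * a / c ^+ 2 = u * q ^+ i by rewrite /u; field; nz.
have e5 : q / q ^+ l / a = q / (q ^+ (l - i) * a * q ^+ i).
  by rewrite -[in q ^+ l](subnK il) exprD; field; nz.
have e6 : d ^+ 2 / b = q / (q ^+ (l - i) * a * q ^+ k * q ^+ i).
  by rewrite /d /b /u -[in q ^+ l](subnK il) exprD; field; nz.
have e7 : d / (b * q ^- l) = q ^+ l * (c / a) / q ^+ k.
  by rewrite /d /b /u; field; nz.
rewrite e1 e2 e3 e4 e5 e6 e7 -/u.
set v := q ^+ (l - i) * a.
have v0 : v != 0 by rewrite mulf_neq0.
have vk0 : v * q ^+ k != 0 by rewrite mulf_neq0.
have nv s t : qpoch q (v * q ^+ s) t != 0.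
  by rewrite /v [_ * a]mulrC -mulrA -exprD; exact: n5.
have nv0 t : qpoch q v t != 0 by have := nv 0%N t; rewrite expr0 mulr1.
(* [c3] and [c4] exchange products of length [k] at parameters shifted by [i] for products of length
   [i] shifted by [k]; note v q^i = a q^l. *)
have c3 : qpoch q v k = qpoch q v i * qpoch q (a * q ^+ l) k / qpoch q (v * q ^+ k) i.
  apply: (canRL (mulfK _)) => //; rewrite -qpochD addnC qpochD.
  by congr (_ * qpoch q _ k); rewrite /v mulrAC -exprD subnK // mulrC.
have c4 : qpoch q (u * q ^+ i) k = qpoch q u k * qpoch q b i / qpoch q u i.
  apply: (canRL (mulfK _)); last by rewrite mulrC -!qpochD addnC.
  by have := n11 0%N i; rewrite expr0 mulr1.
have sgi : (-1) ^+ i != 0 :> F by rewrite signr_eq0.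
rewrite c3 c4 !qpoch_reverseE ?subnn ?qpoch0 ?oner_neq0 //.
rewrite !exprMn !exprVn.
have h1 := nv k i; have h2 := nv0 i; have h3 := hq i; have h4 := n10 k.
have h5 : qpoch q u i != 0 by have := n11 0%N i; rewrite expr0 mulr1.
have h6 : qpoch q (q ^+ 2 / q ^+ l / c ^+ 2) i != 0.
  apply: (@indep_qpoch _ _ (l + l) 0 4 4 0 0) => //.
  by rewrite !exprD; field; nz.
have cl0 : (c * q ^+ l) ^+ 2 != 0 by rewrite expf_neq0 // mulf_neq0.
rewrite /d in n2.
by field; nz; try exact: expf_neq0; nzm cl0 n2.
Qed.
End Connection.

(** * The identity for independent parameters *)

Section Summand.
Variables (F : fieldType) (q : F).
Implicit Types (x y A B C a b c d : F) (n k j : nat).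

Variables (a c : F).
Hypotheses (q0 : q != 0) (a0 : a != 0) (c0 : c != 0) (gen : indep q a c).

(** Replaces integer exponents by quotients of natural powers, which [field] and [ring] can
    handle. *)
Lemma exprz_subn (z : int) s t : z + t%:Z = s%:Z -> q ^ z = q ^+ s / q ^+ t.
Proof.
move=> h; apply: (canRL (mulfK _)); first by rewrite expf_neq0.
by rewrite !exprnP -expfzDr // h.
Qed.

Lemma TtermE l m n i j : (i <= l)%N -> (j <= m)%N ->
  Tterm q a c l m n i j
  = connection_coef q a c l i
    * (let A := q ^+ (l - i) * a in let B := q / q ^+ l * q ^+ i * a / c ^+ 2 in
       contig_coef q m n j
      * (qpoch q (q ^- (m + n)) j * qpoch q (- q ^- (m + n)) j
         * qpoch q A j * qpoch q B j / qpoch (q ^+ 2) (q * A * B) j)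
      * (qpoch (q ^+ 2) (q * (A * q ^+ j)) (m + n - j)
         * qpoch (q ^+ 2) (q * (B * q ^+ j)) (m + n - j)
         / (qpoch (q ^+ 2) q (m + n - j)
            * qpoch (q ^+ 2) (q * (A * q ^+ j) * (B * q ^+ j)) (m + n - j)))).
Proof.
move=> il jm; rewrite /Tterm /connection_coef /contig_coef /= !qpochsE.
set M := (m + n)%N.
have N0 s : q ^+ s != 0 by rewrite expf_neq0.
(* qAB does not depend on i, and as a square it splits by [qpoch_sqr] into the lower parameters qa/c
   and -qa/c of T_{i,j}. *)
have -> : q * (q ^+ (l - i) * a) * (q / q ^+ l * q ^+ i * a / c ^+ 2) = (q * a / c) ^+ 2.
  by rewrite -[in q ^+ l](subnK il) exprD; field; nz.
have -> : q * (q ^+ (l - i) * a * q ^+ j) * (q / q ^+ l * q ^+ i * a / c ^+ 2 * q ^+ j)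
    = q ^ (2 + 2 * j%:Z) * a ^+ 2 / c ^+ 2.
  rewrite (@exprz_subn _ (2 + j + j)%N 0); last by lia.
  by rewrite -[in q ^+ l](subnK il) !exprD; field; nz.
rewrite qpoch_sqr.
rewrite (@exprz_subn (- m%:Z) 0 m); last by lia.
rewrite (@exprz_subn (- m%:Z - n%:Z) 0 M); last by lia.
rewrite (@exprz_subn (- m%:Z - 2 * n%:Z) 0 (M + n)%N); last by lia.
rewrite (@exprz_subn (j%:Z - 2 * m%:Z - 2 * n%:Z - 1) j (M.*2.+1)%N); last by lia.
rewrite (@exprz_subn (l%:Z - i%:Z) (l - i)%N 0); last by lia.
rewrite (@exprz_subn (1 + l%:Z - i%:Z + j%:Z) (1 + (l - i) + j)%N 0); last by lia.
rewrite (@exprz_subn (2 - l%:Z + i%:Z + j%:Z) (2 + i + j)%N l); last by lia.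
rewrite (@exprz_subn (1 - l%:Z + i%:Z) (1 + i)%N l); last by lia.
rewrite (@exprz_subn (1 - l%:Z) 1 l); last by lia.
rewrite (@exprz_subn (2 - l%:Z) 2 l); last by lia.
rewrite (@exprz_subn (- l%:Z) 0 l); last by lia.
rewrite (@exprz_subn (1 - 2 * l%:Z) 1 (l + l)); last by lia.
rewrite (@exprz_subn (1 - 2 * l%:Z + 2 * i%:Z) (1 + i + i) (l + l)); last by lia.
move: 'C(j.+1, 2) => C.
rewrite (@exprz_subn (l%:Z * i%:Z - n%:Z * j%:Z + C%:Z) (l * i + C) (n * j)); last by lia.
rewrite !expr0 !expr1 !mul1r !invr1 !mulr1.
have -> : q ^+ (1 + i + i) = q * (q ^+ i) ^+ 2 by rewrite !exprD expr1 expr2 mulrA.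
have -> : q ^+ (l + l) = (q ^+ l) ^+ 2 by rewrite exprD expr2.
have -> : q ^+ (l * i + C) = (q ^+ l) ^+ i * q ^+ C by rewrite exprD exprM.
have -> : q ^+ j / q ^+ M.*2.+1 = q ^+ j / (q ^+ M.*2 * q) by rewrite exprSr.
have -> : q ^+ (1 + i) / q ^+ l * a / c ^+ 2 = q / q ^+ l * q ^+ i * a / c ^+ 2.
  by rewrite exprD expr1; ring.
have -> : q ^+ (1 + (l - i) + j) * a = q * (q ^+ (l - i) * a * q ^+ j).
  by rewrite !exprD expr1; ring.
have -> : q ^+ (2 + i + j) / q ^+ l * a / c ^+ 2
    = q * (q / q ^+ l * q ^+ i * a / c ^+ 2 * q ^+ j).
  by rewrite !exprD expr2; ring.
rewrite (exprM q n j) !invfM.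
by ring.
Qed.
End Summand.

Section Independent.
Variables (F : fieldType) (q : F).
Implicit Types (x y A B C a b c d : F) (n k j : nat).

Variables (a c : F).
Hypotheses (q0 : q != 0) (a0 : a != 0) (c0 : c != 0) (gen : indep q a c).

Theorem indep_main l m n :
  phi43 n q
    a c (q ^ (- n%:Z)) (- q ^ (1 - l%:Z + m%:Z + n%:Z) * a / c)
    (q ^ (1 - l%:Z) * a / c) (q ^ (1 + m%:Z + n%:Z) * a) (- q ^ (- n%:Z) * c)
    q
  = qpochs q [:: a; c] l
      / qpochs q [:: q ^ (l%:Z - 1) * c ^+ 2; q ^ (1 - l%:Z) * a / c] l
    * (qpochs q [:: q ^ (1 + m%:Z + n%:Z); - (q * a / c)] n
       / qpochs q [:: q ^ (1 + m%:Z + n%:Z) * a; - (q / c)] n)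
    * \sum_(i < l.+1) \sum_(j < m.+1) Tterm q a c l m n i j.
Proof.
set M := (m + n)%N.
have hq := indep_qpoch_q gen.
have N0 s : q ^+ s != 0 by rewrite expf_neq0.
have ex := exprz_subn q0.
have -> : q ^ (- n%:Z) = q ^- n by rewrite exprnN.
have -> : q ^ (1 - l%:Z) = q / q ^+ l by rewrite (ex _ 1 l) ?expr1; last by lia.
have -> : q ^ (l%:Z - 1) = q ^+ l / q by rewrite (ex _ l 1) ?expr1; last by lia.
have -> : q ^ (1 - l%:Z + m%:Z + n%:Z) = q ^+ M.+1 / q ^+ l.
  by rewrite (ex _ M.+1 l) //; rewrite /M; lia.
have -> : q ^ (1 + m%:Z + n%:Z) = q ^+ M.+1.
  by rewrite (ex _ M.+1 0) ?expr0 ?divr1 // /M; lia.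
set p := q / q ^+ l * a / c.
set X := - (q ^+ M.+1 / q ^+ l) * a / c.
set f := - q ^- n * c.
set e := q ^+ M.+1 * a.
have p0 : p != 0 by rewrite !mulf_neq0 ?invr_neq0.
have X0 : X != 0 by rewrite !mulf_neq0 ?oppr_eq0 ?mulf_neq0 ?invr_neq0.
have f0 : f != 0 by rewrite !mulf_neq0 ?oppr_eq0 ?invr_neq0.
have e0 : e != 0 by rewrite !mulf_neq0.
have np t : qpoch q p t != 0.
  apply: (@indep_qpoch _ _ _ _ gen _ _ (l + l) 0 2 2 2 0) => //.
  by rewrite /p !exprD; field; nz.
have ne t : qpoch q e t != 0.
  apply: (@indep_qpoch _ _ _ _ gen _ _ 0 0 0 (M.+1 + M.+1) 2 0) => //.
  by rewrite /e !exprD; field; nz.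
have nf t : qpoch q f t != 0.
  apply: (@indep_qpoch _ _ _ _ gen _ _ (n + n) 0 0 0 0 2) => //.
  by rewrite /f !exprD; field; nz.
have nD t : qpoch q (c * X / p / q) t != 0.
  apply: (@indep_qpoch _ _ _ _ gen _ _ 2 0 0 (M + M) 0 2) => //.
  by rewrite /X /p (exprS _ M) !exprD; field; nz.
have nfa t : qpoch q (f / a) t != 0.
  apply: (@indep_qpoch _ _ _ _ gen _ _ (n + n) 2 0 0 0 2) => //.
  by rewrite /f !exprD; field; nz.
have ea : e / a = q ^+ M.+1 by rewrite /e mulfK.
have nea : qpoch q (e / a) n != 0.
  have := hq (M + n)%N; rewrite qpochD mulf_eq0 negb_or => /andP[_].
  by rewrite ea exprS.
have bal : p * e * f * q ^+ n = a * c * X * q.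
  by rewrite /p /e /f /X; field; nz.
(* Here c, X, p take the places of b, c, d, so that bc/d is -q^M c. *)
rewrite (sears_transformation q0 a0 c0 X0 p0 e0 f0 bal) //.
have -> : q / (e / a * q ^+ n) = q ^- (M + n).
  by rewrite ea exprS exprD; field; nz.
have fa : q / (f / a * q ^+ n) = - (q * a / c) by rewrite /f; field; nz.
have fq : q / (f * q ^+ n) = - (q / c) by rewrite /f; field; nz.
rewrite fa.
have -> : p / c = q / q ^+ l * a / c ^+ 2 by rewrite /p; field; nz.
have -> : p / X = - q ^- M.
  by rewrite /p /X (exprS _ M); field; nz; rewrite oppr_eq0 mulf_neq0.
have -> : phi43 n q a (q / q ^+ l * a / c ^+ 2) (q ^- n) (- q ^- M) p
      (q ^- (M + n)) (- (q * a / c)) q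
  = qpochs q [:: a; c] l / qpochs q [:: q ^+ l / q * c ^+ 2; p] l
    * \sum_(i < l.+1) \sum_(j < m.+1) Tterm q a c l m n i j.
  have nr t : qpoch q (q * a / c) t != 0.
    by apply: (@indep_qpoch _ _ _ _ gen _ _ 0 0 2 2 2 0) => //; field; nz.
  have nr' t : qpoch q (- (q * a / c)) t != 0.
    by apply: (@indep_qpoch _ _ _ _ gen _ _ 0 0 2 2 2 0) => //; field; nz.
  pose A i := q ^+ (l - i) * a.
  pose B i := q / q ^+ l * q ^+ i * a / c ^+ 2.
  have AB i : (i <= l)%N -> q * A i * B i = (q * a / c) ^+ 2.
    by move=> il; rewrite /A /B -[in q ^+ l](subnK il) exprD; field; nz.
  pose W i k := qpoch q (q ^- n) k * qpoch q (A i) k * qpoch q (B i) k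
      * qpoch q (- q ^- M) k * q ^+ k
    / (qpoch q q k * qpoch (q ^+ 2) (q * A i * B i) k * qpoch q (q ^- (M + n)) k).
  (* [connection] introduces the sum over i; for each i the sum of [W i k] over k is then a
     left-hand side of [q_watson_contiguous]. *)
  transitivity (qpochs q [:: a; c] l / qpochs q [:: q ^+ l / q * c ^+ 2; p] l
    * \sum_(i < l.+1) connection_coef q a c l i * \sum_(k < n.+1) W i k).
    have -> : \sum_(i < l.+1) connection_coef q a c l i * (\sum_(k < n.+1) W i k)
        = \sum_(k < n.+1) \sum_(i < l.+1) connection_coef q a c l i * W i k.
      by rewrite exchange_big; apply: eq_bigr => i _; rewrite mulr_sumr.
    rewrite mulr_sumr; apply: eq_bigr => -[k klt] _ /=.
    have con := connection q0 a0 c0 gen l k; rewrite -/p in con.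
    rewrite !qpochsE.
    pose Z := qpoch q (q ^- n) k * qpoch q (- q ^- M) k * q ^+ k
      / (qpoch q q k * qpoch q (q ^- (M + n)) k * qpoch q (- (q * a / c)) k).
    transitivity (qpoch q a k * qpoch q (q / q ^+ l * a / c ^+ 2) k / qpoch q p k * Z).
      by rewrite /Z !invfM; ring.
    rewrite con -mulrA; congr (_ * _); rewrite mulr_suml.
    apply: eq_bigr => -[i ilt] _ /=; rewrite /W AB // qpoch_sqr /Z /A /B -mulrA.
    by congr (_ * _); rewrite !invfM; ring.
  congr (_ * _); apply: eq_bigr => -[i ilt] _ /=.
  have il : (i <= l)%N by [].
  rewrite /W q_watson_contiguous //; last first.
    by move=> s; rewrite AB // qpoch_sqr mulf_neq0.
  rewrite mulr_sumr; apply: eq_bigr => -[j jlt] _ /=.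
  by rewrite TtermE.
rewrite !qpochsE mulrA; congr (_ * _).
(* Reversing all [n] factors turns (-qa/c)_n / (-q/c)_n into a^n (f/a)_n / (f)_n, the prefactor of
   Sears' transformation. *)
rewrite ea -fa -fq !qpoch_reverseE ?subnn ?qpoch0 ?oner_neq0 //.
  have sg : (-1) ^+ n != 0 :> F by rewrite signr_eq0.
  rewrite expr_div_n.
  have h1 := ne n; have h2 := nf n; have h3 := np l.
  have h4 : qpoch q (q ^+ l / q * c ^+ 2) l != 0.
    apply: (@indep_qpoch _ _ _ _ gen _ _ 2 0 0 (l + l) 0 4) => //.
    by rewrite !exprD; field; nz.
  by field; nz; exact: expf_neq0 (N0 n).
by rewrite mulf_neq0 ?invr_neq0.
Qed.
End Independent.

(** * Specialisation *)

Local Notation "p %:F" := (@FracField.tofrac _ p).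

Section Specialisation.
Variables (C : fieldType) (x : C).
Let K : fieldType := {fraction {poly C}}.

(* The rational function [f] is defined at [x], with value [v]. *)
Definition regular (f : K) (v : C) :=
  exists p r : {poly C}, [/\ r.[x] != 0, f * r%:F = p%:F & v * r.[x] = p.[x]].

(** Two representations of [f] satisfy p r' = p' r as polynomials, because the embedding into
    fractions is injective; evaluation at [x] gives the claim. *)
Lemma regular_uniq f v w : regular f v -> regular f w -> v = w.
Proof.
move=> [p [r [r0 fp vp]]] [p' [r' [r0' fp' wp']]].
have e : p * r' = p' * r.
  by apply/eqP; rewrite -tofrac_eq !tofracM -fp -fp'; apply/eqP; ring.
apply: (mulIf (mulf_neq0 r0 r0')); rewrite mulrA vp [r.[x] * _]mulrC mulrA wp'.
by rewrite -!hornerM e.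
Qed.

Lemma regular_poly p : regular p%:F p.[x].
Proof. by exists p, 1; rewrite hornerC oner_neq0 tofrac1 !mulr1. Qed.

Lemma regular1 : regular 1 1.
Proof. by have := regular_poly 1; rewrite hornerC tofrac1. Qed.

Lemma regular0 : regular 0 0.
Proof. by have := regular_poly 0; rewrite hornerC tofrac0. Qed.

Lemma regularN f v : regular f v -> regular (- f) (- v).
Proof.
move=> [p [r [r0 fp vp]]]; exists (- p), r.
by rewrite hornerN tofracN !mulNr fp vp.
Qed.

Lemma regularD f v g w : regular f v -> regular g w -> regular (f + g) (v + w).
Proof.
move=> [p [r [r0 fp vp]]] [p' [r' [r0' gp' wp']]].
exists (p * r' + p' * r), (r * r'); rewrite hornerD !hornerM mulf_neq0 //.
split=> //; last by rewrite -vp -wp'; ring.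
by rewrite tofracD !tofracM -fp -gp'; ring.
Qed.

Lemma regularM f v g w : regular f v -> regular g w -> regular (f * g) (v * w).
Proof.
move=> [p [r [r0 fp vp]]] [p' [r' [r0' gp' wp']]].
exists (p * p'), (r * r'); rewrite !hornerM mulf_neq0 //.
split=> //; last by rewrite -vp -wp'; ring.
by rewrite !tofracM -fp -gp'; ring.
Qed.

Lemma regularV f v : v != 0 -> regular f v -> regular f^-1 v^-1.
Proof.
move=> v0 [p [r [r0 fp vp]]].
have p0 : p.[x] != 0 by rewrite -vp mulf_neq0.
exists r, p; split=> //; last by rewrite -vp mulKf.
rewrite -fp mulKf //; apply: contraNneq p0 => f0.
by move: fp; rewrite f0 mul0r => /eqP; rewrite eq_sym tofrac_eq0 => /eqP ->; rewrite horner0.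
Qed.

Lemma regularX f v n : regular f v -> regular (f ^+ n) (v ^+ n).
Proof.
move=> h; elim: n => [|n IH]; first exact: regular1.
by rewrite !exprS; apply: regularM.
Qed.

Lemma regular_exprz f v (z : int) : v != 0 -> regular f v -> regular (f ^ z) (v ^ z).
Proof.
move=> v0 h; case: z => n; first exact: regularX.
by rewrite NegzE -!exprnN; apply: regularV; [rewrite expf_neq0|exact: regularX].
Qed.

Lemma regular_sum n (f : 'I_n -> K) v : (forall i, regular (f i) (v i)) ->
  regular (\sum_(i < n) f i) (\sum_(i < n) v i).
Proof.
move=> h; apply: (big_ind2 regular) => [|? ? ? ? ? ?|i _]; [exact: regular0| |exact: h].
exact: regularD.
Qed.

Lemma regular_qpoch q1 q f v n : regular q1 q -> regular f v ->
  regular (qpoch q1 f n) (qpoch q v n).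
Proof.
move=> hq h; apply: (big_ind2 regular) => [|? ? ? ? ? ?|i _]; [exact: regular1|exact: regularM|].
apply: regularD; first exact: regular1.
by apply: regularN; apply: regularM => //; apply: regularX.
Qed.

Lemma regular_qpochs_nil q1 q n : regular (qpochs q1 [::] n) (qpochs q [::] n).
Proof. by rewrite !qpochs_nil; exact: regular1. Qed.

Lemma regular_qpochs_cons q1 q f v fs vs n : regular q1 q -> regular f v ->
  regular (qpochs q1 fs n) (qpochs q vs n) ->
  regular (qpochs q1 (f :: fs) n) (qpochs q (v :: vs) n).
Proof.
move=> hq h1 h2; rewrite !qpochs_cons.
by apply: regularM => //; apply: regular_qpoch.
Qed.

End Specialisation.

(** The exponent is the multiplicity of the root [z]: after cancelling the smaller power, a positive
    remaining power would force the other cofactor to vanish at [z]. *)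
Lemma XsubC_exp_inj (C : fieldType) (z : C) i i' (p p' : {poly C}) :
  ~~ root p z -> ~~ root p' z ->
  ('X - z%:P) ^+ i * p = ('X - z%:P) ^+ i' * p' -> i = i'.
Proof.
wlog ii : i i' p p' / (i <= i')%N => [hw|] h h' e.
  case/orP: (leq_total i i') => ii; first exact: (hw i i' p p').
  by apply/esym; apply: (hw i' i p' p).
have X0 : ('X - z%:P) ^+ i != 0 by rewrite expf_neq0 // polyXsubC_eq0.
move: e; rewrite -(subnK ii) addnC exprD -mulrA => /(mulfI X0) e.
case: (posnP (i' - i)) => [->|d0]; first by rewrite addn0.
by move: h; rewrite e rootE hornerM horner_exp hornerXsubC subrr expr0n gtn_eqF // mul0r eqxx.
Qed.

(** The three roots are distinct, so each exponent can be read off as the multiplicity of its own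
    root. *)
Lemma indep_XsubC (C : fieldType) (z1 z2 z3 u1 u2 u3 : C) :
  z1 != z2 -> z1 != z3 -> z2 != z3 -> u1 != 0 -> u2 != 0 -> u3 != 0 ->
  indep ((u1 *: ('X - z1%:P))%:F : {fraction {poly C}})
    (u2 *: ('X - z2%:P))%:F (u3 *: ('X - z3%:P))%:F.
Proof.
move=> h12 h13 h23 h1 h2 h3 i j k i' j' k'.
rewrite -!tofracXn -!tofracM => /eqP; rewrite tofrac_eq => /eqP.
rewrite !exprZn => e.
have nP (u v w y z s : C) n1 n2 n3 : s != y -> s != z -> u != 0 -> v != 0 -> w != 0 ->
    ~~ root (u ^+ n1 *: (v ^+ n2 *: ('X - y%:P) ^+ n2 * (w ^+ n3 *: ('X - z%:P) ^+ n3))) s.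
  move=> *; rewrite rootZ ?expf_neq0 // rootM !rootZ ?expf_neq0 // negb_or.
  by rewrite /root !horner_exp !hornerXsubC !expf_neq0 // subr_eq0.
split.
- apply: (@XsubC_exp_inj _ z1 _ _ _ _ (nP u1 u2 u3 z2 z3 z1 i j k _ _ _ _ _)
    (nP u1 u2 u3 z2 z3 z1 i' j' k' _ _ _ _ _)) => //.
  transitivity (u1 ^+ i *: ('X - z1%:P) ^+ i * (u2 ^+ j *: ('X - z2%:P) ^+ j)
    * (u3 ^+ k *: ('X - z3%:P) ^+ k)).
    by rewrite -!mul_polyC; ring.
  by rewrite e -!mul_polyC; ring.
- apply: (@XsubC_exp_inj _ z2 _ _ _ _ (nP u2 u1 u3 z1 z3 z2 j i k _ _ _ _ _)
    (nP u2 u1 u3 z1 z3 z2 j' i' k' _ _ _ _ _)) => //; rewrite 1?eq_sym //.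
  transitivity (u1 ^+ i *: ('X - z1%:P) ^+ i * (u2 ^+ j *: ('X - z2%:P) ^+ j)
    * (u3 ^+ k *: ('X - z3%:P) ^+ k)).
    by rewrite -!mul_polyC; ring.
  by rewrite e -!mul_polyC; ring.
- apply: (@XsubC_exp_inj _ z3 _ _ _ _ (nP u3 u1 u2 z1 z2 z3 k i j _ _ _ _ _)
    (nP u3 u1 u2 z1 z2 z3 k' i' j' _ _ _ _ _)) => //; rewrite 1?eq_sym //.
  transitivity (u1 ^+ i *: ('X - z1%:P) ^+ i * (u2 ^+ j *: ('X - z2%:P) ^+ j)
    * (u3 ^+ k *: ('X - z3%:P) ^+ k)).
    by rewrite -!mul_polyC; ring.
  by rewrite e -!mul_polyC; ring.
Qed.

(** Follows the syntax of an expression; the goals that remain are nonvanishing conditions on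
    denominators. *)
Ltac reg := repeat first
  [ assumption | apply: regular_exprz
  | apply: regular1 | apply: regularN | apply: regularD | apply: regularM
  | apply: regularX | apply: regular_qpochs_nil | apply: regular_qpochs_cons
  | apply: regularV | apply: regular_sum => ? ].

Theorem mainTheorem9 (R : realType) (q a c : R[i]) (l m n : nat)
  (hq : q != 0) (ha : a != 0) (hc : c != 0)
  (* no zero factor in a denominator of the left-hand side *)
  (hphi : forall k : nat, (k <= n)%N ->
     qpochs q [:: q; q ^ (1 - l%:Z) * a / c; q ^ (1 + m%:Z + n%:Z) * a;
                  - q ^ (- n%:Z) * c] k != 0)
  (* nor in a denominator of the prefactor *)
  (hl : qpochs q [:: q ^ (l%:Z - 1) * c ^+ 2; q ^ (1 - l%:Z) * a / c] l != 0)
  (hn : qpochs q [:: q ^ (1 + m%:Z + n%:Z) * a; - (q / c)] n != 0)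
  (* nor in a denominator of T_{i,j} *)
  (hT0 : 1 - q ^ (1 - 2 * l%:Z) / c ^+ 2 != 0)
  (hTi : forall i : nat, (i <= l)%N ->
     qpochs q [:: q; q ^ (1 - l%:Z) / a; q ^ (2 - l%:Z) / c ^+ 2] i != 0)
  (hTj : forall j : nat, (j <= m)%N ->
     qpochs q [:: q; q * a / c; - (q * a / c); q ^ (- m%:Z - 2 * n%:Z);
                  q ^ (j%:Z - 2 * m%:Z - 2 * n%:Z - 1)] j != 0)
  (hTij : forall j : nat, (j <= m)%N ->
     qpochs (q ^+ 2) [:: q; q ^ (2 + 2 * j%:Z) * a ^+ 2 / c ^+ 2] (m + n - j)
       != 0) :
  phi43 n q
    a c (q ^ (- n%:Z)) (- q ^ (1 - l%:Z + m%:Z + n%:Z) * a / c)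
    (q ^ (1 - l%:Z) * a / c) (q ^ (1 + m%:Z + n%:Z) * a) (- q ^ (- n%:Z) * c)
    q
  = qpochs q [:: a; c] l
      / qpochs q [:: q ^ (l%:Z - 1) * c ^+ 2; q ^ (1 - l%:Z) * a / c] l
    * (qpochs q [:: q ^ (1 + m%:Z + n%:Z); - (q * a / c)] n
       / qpochs q [:: q ^ (1 + m%:Z + n%:Z) * a; - (q / c)] n)
    * \sum_(i < l.+1) \sum_(j < m.+1) Tterm q a c l m n i j.
Proof.
pose C : fieldType := R[i].
have n0 (k : nat) : k.+1%:R != 0 :> C by rewrite pnatr_eq0.
(* The linear polynomial with root [z] and value [u] at 3. The roots 0, 1, 2 and the point 3 are
   distinct in characteristic 0. *)
pose path (u z : C) : {fraction {poly C}} := ((u / (3 - z)) *: ('X - z%:P))%:F.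
have regP (u z : C) : 3 - z != 0 -> regular 3 (path u z) u.
  move=> z3; have := regular_poly (3 : C) ((u / (3 - z)) *: ('X - z%:P)).
  by rewrite hornerZ hornerXsubC mulfVK.
have e30 : 3 - 0 != 0 :> C by rewrite subr0 n0.
have e31 : 3 - 1 != 0 :> C.
  by rewrite (_ : 3 - 1 = 2%:R); [exact: n0 | ring].
have e32 : 3 - 2 != 0 :> C.
  by rewrite (_ : 3 - 2 = 1%:R); [exact: n0 | ring].
pose q1 := path q 0; pose a1 := path a 1; pose c1 := path c 2.
have rq : regular 3 q1 q by exact: regP.
have ra : regular 3 a1 a by exact: regP.
have rc : regular 3 c1 c by exact: regP.
have nzP (u z : C) : 3 - z != 0 -> u != 0 -> path u z != 0.
  move=> z3 u0; rewrite /path tofrac_eq0 scaler_eq0 negb_or polyXsubC_eq0.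
  by rewrite mulf_neq0 ?invr_neq0.
have h01 : 0 != 1 :> C by rewrite eq_sym oner_neq0.
have h02 : 0 != 2 :> C by rewrite eq_sym n0.
have h12 : 1 != 2 :> C.
  by rewrite -subr_eq0 (_ : 1 - 2 = - 1%:R) ?oppr_eq0 ?n0 //; ring.
have ind : indep q1 a1 c1.
  by apply: indep_XsubC; rewrite // mulf_neq0 ?invr_neq0.
have q10 : q1 != 0 by exact: nzP.
have a10 : a1 != 0 by exact: nzP.
have c10 : c1 != 0 by exact: nzP.
have main := indep_main q10 a10 c10 ind l m n.
have rL : regular 3 (phi43 n q1
    a1 c1 (q1 ^ (- n%:Z)) (- q1 ^ (1 - l%:Z + m%:Z + n%:Z) * a1 / c1)
    (q1 ^ (1 - l%:Z) * a1 / c1) (q1 ^ (1 + m%:Z + n%:Z) * a1) (- q1 ^ (- n%:Z) * c1)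
    q1)
  (phi43 n q
    a c (q ^ (- n%:Z)) (- q ^ (1 - l%:Z + m%:Z + n%:Z) * a / c)
    (q ^ (1 - l%:Z) * a / c) (q ^ (1 + m%:Z + n%:Z) * a) (- q ^ (- n%:Z) * c)
    q).
  rewrite /phi43; apply: regular_sum => k.
  by reg; apply: hphi; rewrite -ltnS.
(* By [main] both sides come from one rational function, so their values at 3 agree once the
   right-hand side is regular there; the denominators to check are those of the hypotheses. *)
apply: (regular_uniq rL); rewrite main /Tterm.
have hc2 : c ^+ 2 != 0 by rewrite expf_neq0.
by reg; [apply: hTi|apply: hTj|apply: hTij]; rewrite -ltnS.
Qed.
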